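(* Consider the mixed Dirichlet–Neumann case $\mathcal E_{\rm ext}^D\ne\emptyset$. For every $p\in(1,2]$ there exists a constant $\kappa_p>0$, depending only on $p$, $\Omega$, $\Gamma^D$, the mesh regularity parameter $\zeta$, the boundary datum $u^D$ and the potential $V$, such that for any $k>0$, if $\Delta t\le k$, every solution $(\boldsymbol u^n)_{n\ge0}$ of the nonlinear TPFA scheme satisfies $$\mathbb E_p^n\le(1+\kappa_p\,\Delta t)^{-n}\,\mathbb E_p^0\qquad\text{for all }n\ge0 .$$ Consequently, for any $k>0$, if $\Delta t\le k$, then $\mathbb E_p^n\le e^{-\tilde\kappa_p t^n}\,\mathbb E_p^0$ for all $n\ge0$, where $\tilde\kappa_p=\log(1+\kappa_pk)/k$ and $t^n=n\Delta t$.
   Context: **Data.** $\Omega\subset\mathbb R^2$ is a polygonal connected open bounded set, $\partial\Omega=\Gamma^D\cup\Gamma^N$ (Dirichlet and no-flux parts), $V\in C^1(\overline\Omega,\mathbb R)$, $u_0\in L^2(\Omega)$, $u_0\ge0$. The boundary datum is $u^D(\boldsymbol x)=\rho e^{-V(\boldsymbol x)}$ on $\Gamma^D$ for some constant $\rho>0$. The scheme discretizes $\partial_tu-\mathrm{div}(\nabla u+u\nabla V)=0$ with $u=u^D$ on $\Gamma^D$, no-flux condition on $\Gamma^N$, and initial datum $u_0$. **Mesh.** An admissible mesh $(\mathcal T,\mathcal E,\mathcal P)$ of $\Omega$: $\mathcal T$ is a finite family of disjoint open convex polygonal control volumes $K\subset\Omega$ whose closures cover $\overline\Omega$; $\mathcal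 E$ is a finite family of edges (segments of positive length); for each $K$, $\mathcal E_K\subset\mathcal E$ is the set of its edges, $\partial K=\bigcup_{\sigma\in\mathcal E_K}\overline\sigma$, and $\mathcal E=\bigcup_K\mathcal E_K$; for $K\ne L$ either $\overline K\cap\overline L$ has zero length or $\overline K\cap\overline L=\overline\sigma$ for some $\sigma\in\mathcal E$, denoted $\sigma=K|L$ (interior edges, $\mathcal E_{\rm int}$); the other edges lie on $\partial\Omega$ ($\mathcal E_{\rm ext}$), each being contained in $\Gamma^D$ ($\mathcal E_{\rm ext}^D$) or in $\Gamma^N$ ($\mathcal E_{\rm ext}^N$). $\mathcal P=(\boldsymbol x_K)_{K\in\mathcal T}$ with $\boldsymbol x_K\in K$; for $\sigma=K|L$, $\boldsymbol x_K\neq\boldsymbol x_L$ and the line through $\boldsymbol x_K,\boldsymbol x_L$ is orthogonal to $\sigma$; for exterior $\sigma\in\mathcal E_K$, the line through $\boldsymbol x_K$ orthogonal to $\sigma$ meets $\sigma$. $\boldsymbol x_\sigma$ is the midpoint of $\sigma$, $\mathrm m_K$ the area of $K$, $\mathrm m_\sigma$ the length of $\sigma$, $d(\boldsymbol x_K,\sigma)$ the distance from $\boldsymbol x_K$ to its orthogonal projection on the line containing $\sigma$, $\mathrm d_\sigma=|\boldsymbol x_K-\boldsymbol x_L|$ if $\sigma=K|L$, $\mathrm d_\sigma=d(\boldsymbol x_K,\sigma)$ if $\sigma\in\mathcal E_K\cap\mathcal E_{\rm ext}$, $\tau_\sigma=\mathrm m_\sigma/\mathrm d_\sigma$. Regularity: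 $\zeta>0$ is such that $d(\boldsymbol x_K,\sigma)\ge\zeta\,\mathrm d_\sigma$ for all $K\in\mathcal T$, $\sigma\in\mathcal E_K$. $\Delta t>0$ is the time step. **Function $r$.** $r:(0,\infty)^2\to(0,\infty)$ is monotonically increasing (non-strictly) in each variable, $r(x,x)=x$, $r(x,y)=r(y,x)$, $r(\lambda x,\lambda y)=\lambda r(x,y)$ for all $\lambda>0$, and $\frac{x-y}{\log x-\log y}\le r(x,y)\le\max(x,y)$ for $x\ne y$. **Scheme.** Put $V_K=V(\boldsymbol x_K)$, and for $\sigma\in\mathcal E_{\rm ext}^D$, $V_\sigma=V(\boldsymbol x_\sigma)$, $u_\sigma^D=u^D(\boldsymbol x_\sigma)=\rho e^{-V_\sigma}$; $u_K^0=\frac1{\mathrm m_K}\int_Ku_0\,d\boldsymbol x$. A solution is a sequence $\boldsymbol u^n=(u_K^n)_{K\in\mathcal T}$, $n\ge0$, with $u_K^n>0$ for all $K$ and $n\ge1$, such that for all $n\ge0$, $K\in\mathcal T$ $$\mathrm m_K\frac{u_K^{n+1}-u_K^n}{\Delta t}+\sum_{\sigma\in\mathcal E_K}\mathcal F_{K,\sigma}^{n+1}=0,$$ where $\mathcal F_{K,\sigma}^{n+1}=-\tau_\sigma r(u_K^{n+1},u_L^{n+1})(\log u_L^{n+1}+V_L-\log u_K^{n+1}-V_K)$ if $\sigma=K|L$, $\mathcal F_{K,\sigma}^{n+1}=-\tau_\sigma r(u_K^{n+1},u_\sigma^D)(\log u_\sigma^D+V_\sigma-\log u_K^{n+1}-V_K)$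 if $\sigma\in\mathcal E_{\rm ext}^D$, and $\mathcal F_{K,\sigma}^{n+1}=0$ if $\sigma\in\mathcal E_{\rm ext}^N$. **Steady state.** $u_K^\infty=\rho e^{-V_K}$ for $K\in\mathcal T$, with the same $\rho$ as in $u^D$. **Relative entropies.** For $p\in(1,2]$, $\mathbb E_p^n=\sum_{K\in\mathcal T}\mathrm m_Ku_K^\infty\,\Phi_p(u_K^n/u_K^\infty)$ with $\Phi_p(s)=\frac{s^p-ps}{p-1}+1$. *)

(* Defs.v *)
From mathcomp Require Export all_boot all_order all_algebra.
From mathcomp Require Export all_classical all_reals all_analysis.

Set Implicit Arguments.
Unset Strict Implicit.
Unset Printing Implicit Defensive.

Export Order.TTheory GRing.Theory Num.Theory.
Export numFieldNormedType.Exports.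

Local Open Scope classical_set_scope.
Local Open Scope ring_scope.

(* Euclidean structure: the library norm on R * R is the max norm, which has
   the same topology but gives other lengths, so it is not used for lengths. *)

Definition dot {R : realType} (v w : R * R) : R := v.1 * w.1 + v.2 * w.2.

Definition enorm {R : realType} (v : R * R) : R := Num.sqrt (dot v v).

Definition oseg {R : realType} (a b : R * R) : set (R * R) :=
  [set a + t *: (b - a) | t in [set t : R | 0 < t < 1]].

Definition cseg {R : realType} (a b : R * R) : set (R * R) :=
  [set a + t *: (b - a) | t in [set t : R | 0 <= t <= 1]].

Definition proj_line {R : realType} (a b x : R * R) : R * R :=
  a + (dot (x - a) (b - a) / dot (b - a) (b - a)) *: (b - a).

Definition boundary {R : realType} (A : set (R * R)) : set (R * R) :=
  closure A `\` interior A.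

(* One-dimensional Hausdorff measure zero: countable covers by discs with
   arbitrarily small sum of radii. *)
Definition zero_length {R : realType} (A : set (R * R)) : Prop :=
  forall e : R, 0 < e ->
  exists c : nat -> R * R, exists rad : nat -> R,
    [/\ forall i, 0 <= rad i,
        A `<=` \bigcup_i [set x | enorm (x - c i) <= rad i]
      & (\sum_(0 <= i <oo) (rad i)%:E <= e%:E)%E].

Definition lebesgue2 (R : realType) :
    {measure set (measurableTypeR R * measurableTypeR R) -> \bar R} :=
  (@lebesgue_measure R \x @lebesgue_measure R)%E.

Definition polygonal_domain {R : realType} (Om : set (R * R)) : Prop :=
  [/\ open Om, connected Om, bounded_set Om
    & exists s : seq ((R * R) * (R * R)),
        boundary Om = \bigcup_(ab in [set` s]) cseg ab.1 ab.2].

(* C^1 up to the boundary: V and its gradient, defined in Om, extend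
   continuously to the closure of Om. *)
Definition C1_closure {R : realType} (Om : set (R * R)) (V : R * R -> R) :
    Prop :=
  {within closure Om, continuous V} /\
  exists g : R * R -> R * R,
    {within closure Om, continuous g} /\
    forall x, Om x -> differentiable V x /\ forall v, 'D_v V x = dot (g x) v.

Definition L2 {R : realType} (Om : set (R * R)) (f : R * R -> R) : Prop :=
  patch (fun=> 0) Om f \in Lfun (lebesgue2 R) 2%:E.

Record mesh (R : realType) := Mesh {
  cell : finType;
  edge : finType;
  cellset : cell -> set (R * R);
  edges_of : cell -> {set edge};
  end1 : edge -> R * R;
  end2 : edge -> R * R;
  center : cell -> R * R }.

Section MeshGeometry.
Context {R : realType} (M : mesh R).
Implicit Types (K L : cell M) (s : edge M).

(* Edges are relatively open segments. *)
Definition edgeset s : set (R * R) := oseg (end1 s) (end2 s).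

Definition midpoint s : R * R := 2^-1 *: (end1 s + end2 s).

(* s = K|L *)
Definition separates s K L : Prop :=
  [/\ K != L, s \in edges_of K, s \in edges_of L
    & closure (cellset K) `&` closure (cellset L) = closure (edgeset s)].

Definition interior_edge s : Prop := exists K L, separates s K L.

Definition exterior_edge s : Prop := ~ interior_edge s.

Definition cell_area K : R := fine (lebesgue2 R (cellset K)).

Definition edge_length s : R := enorm (end2 s - end1 s).

Definition dist_to_edge K s : R :=
  enorm (center K - proj_line (end1 s) (end2 s) (center K)).

(* [Some L] if s = K|L, [None] if s (an edge of K) is exterior. *)
Definition neighbor K s : option (cell M) :=
  [pick L | `[< separates s K L >]].

(* The value d_s and the transmissivity, computed from a cell K having s
   among its edges (the choice of K is immaterial in an admissible mesh). *)
Definition edge_dist K s : R :=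
  match neighbor K s with
  | Some L => enorm (center K - center L)
  | None => dist_to_edge K s
  end.

Definition transm K s : R := edge_length s / edge_dist K s.

Definition dirichlet_edge (GD : set (R * R)) s : Prop :=
  exterior_edge s /\ edgeset s `<=` GD.

Definition neumann_edge (GN : set (R * R)) s : Prop :=
  exterior_edge s /\ edgeset s `<=` GN.

Record admissible (Om GD GN : set (R * R)) : Prop := Admissible {
  cell_open : forall K : cell M, open (cellset K);
  cell_convex : forall K : cell M, convex_set (cellset K);
  cell_sub : forall K : cell M, cellset K `<=` Om;
  cell_disjoint : forall K L : cell M, K != L -> cellset K `&` cellset L = set0;
  cell_cover : closure Om = \bigcup_(K : cell M) closure (cellset K);
  edge_nondeg : forall s : edge M, end1 s != end2 s;
  edge_disjoint : forall s s' : edge M, s != s' -> edgeset s `&` edgeset s' = set0;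
  edge_used : forall s : edge M, exists K, s \in edges_of K;
  (* together with openness and convexity: K is a convex polygon *)
  cell_boundary : forall K,
    boundary (cellset K) =
      \bigcup_(s in [set s | s \in edges_of K]) closure (edgeset s);
  cell_meet : forall K L : cell M, K != L ->
    zero_length (closure (cellset K) `&` closure (cellset L)) \/
    exists s, separates s K L;
  exterior_boundary : forall s : edge M, exterior_edge s -> edgeset s `<=` boundary Om;
  exterior_type : forall s : edge M, exterior_edge s ->
    dirichlet_edge GD s \/ neumann_edge GN s;
  center_in : forall K : cell M, cellset K (center K);
  center_interior : forall s K L, separates s K L ->
    center K != center L /\ dot (center L - center K) (end2 s - end1 s) = 0;
  (* [closure] admits the endpoints of the edge as feet *)
  center_exterior : forall s K, exterior_edge s -> s \in edges_of K ->
    exists y, closure (edgeset s) y /\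
      dot (y - center K) (end2 s - end1 s) = 0 }.

Definition regular (zeta : R) : Prop :=
  forall K s, s \in edges_of K -> zeta * edge_dist K s <= dist_to_edge K s.

End MeshGeometry.

Record admissible_mean {R : realType} (r : R -> R -> R) : Prop :=
  AdmissibleMean {
  mean_pos : forall x y, 0 < x -> 0 < y -> 0 < r x y;
  mean_mono1 : forall x x' y, 0 < x -> x <= x' -> 0 < y -> r x y <= r x' y;
  mean_mono2 : forall x y y', 0 < x -> 0 < y -> y <= y' -> r x y <= r x y';
  mean_diag : forall x, 0 < x -> r x x = x;
  mean_sym : forall x y, 0 < x -> 0 < y -> r x y = r y x;
  mean_homog : forall l x y, 0 < l -> 0 < x -> 0 < y ->
    r (l * x) (l * y) = l * r x y;
  mean_bounds : forall x y, 0 < x -> 0 < y -> x != y ->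
    (x - y) / (ln x - ln y) <= r x y <= Num.max x y }.

Section Scheme.
Context {R : realType} (GD : set (R * R)) (V : R * R -> R) (rho : R).

Definition uD (x : R * R) : R := rho * expR (- V x).

Context (r : R -> R -> R) (M : mesh R).

Definition flux (w : cell M -> R) (K : cell M) (s : edge M) : R :=
  match neighbor K s with
  | Some L =>
      - transm K s * r (w K) (w L) *
        (ln (w L) + V (center L) - ln (w K) - V (center K))
  | None =>
      let us := uD (midpoint s) in
      if `[< dirichlet_edge GD s >] then
        - transm K s * r (w K) us *
          (ln us + V (midpoint s) - ln (w K) - V (center K))
      else 0
  end.

Record solution (u0 : R * R -> R) (dt : R) (u : nat -> cell M -> R) : Prop :=
  Solution {
  sol_init : forall K,
    u 0%N K =
      (cell_area K)^-1 * (\int[lebesgue2 R]_(x in cellset K) u0 x)%R;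
  sol_pos : forall n K, (0 < n)%N -> 0 < u n K;
  sol_step : forall n K,
    cell_area K * ((u n.+1 K - u n K) / dt) +
      \sum_(s in edges_of K) flux (u n.+1) K s = 0 }.

Definition uinf (K : cell M) : R := rho * expR (- V (center K)).

Definition Phi (p s : R) : R := (s `^ p - p * s) / (p - 1) + 1.

Definition entropy (p : R) (w : cell M -> R) : R :=
  \sum_(K : cell M) cell_area K * uinf K * Phi p (w K / uinf K).

End Scheme.

(* Main.v *)
(* A discrete Poincare inequality, uniform over all admissible meshes, turns the
   entropy dissipation of the scheme into exponential decay.

   Entropy side: with w = u / u^oo, convexity of Phi_p and the bound of [r] from below
   by the logarithmic mean bound the dissipation from below by the sum of the
   tau_sigma (D_sigma w^(p/2))^2, while Phi_p(w) is at most (w^(p/2) - 1)^2 / (p - 1).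

   Poincare side: call a set A good if the integral of v^2 over A is bounded by the
   discrete H^1 seminorm of v with a constant depending on A only.  For a fixed vector
   eta, following the segment from x to x + eta through the cells, Cauchy-Schwarz with
   weights eta.(x_L - x_K), which telescope, and integration over x show that good sets
   can be translated inside the closed domain.  A small set facing a Dirichlet edge is
   good, since the segments leave the domain there.  As the domain is connected, all its
   points have good neighborhoods.  To reach the boundary, fix one mesh of the domain:
   each of its cells is a convex polygon C, which is covered by translates of
   (3/4) C inside C, so C is good as soon as a small homothetic copy of it is.  The
   constant therefore depends only on the domain and its Dirichlet part. *)

(* The constant has to be found before the mesh of the scheme is known, and the domain need not be
   convex: a ray may leave it through the no-flux part before meeting a Dirichlet edge. This is why
   the estimate is stated for subsets of the domain, uniformly over meshes, and carried from set to
   set.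

   Translation costs only a bounded multiple of the dissipation because of a cancellation: the
   starting points whose segment crosses an edge e fill a parallelogram of area at most |det(e,
   eta)|, the Cauchy-Schwarz weight of this edge is d |det(e, eta)| / m, and the quotient is the
   transmissivity m / d, whatever the direction of eta.

   The rate is e^(-2 Vm) p (p - 1) / (2 C), with Vm a bound of |V| and C the Poincare constant: the
   exponentials compare the steady state with constants, 1/2 comes from symmetrizing the sum over
   edges, p from the dissipation and p - 1 from the bound of Phi_p. *)
Require Import Defs.
From mathcomp Require Import ring lra measurable_realfun.
Set Implicit Arguments.
Unset Strict Implicit.
Unset Printing Implicit Defensive.
Local Open Scope classical_set_scope.
Local Open Scope ring_scope.

(** * Lebesgue measure in the plane *)

Section PlaneMeasure.
Context {R : realType}.
Local Notation T := (measurableTypeR R).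
Local Notation leb := (@lebesgue_measure R).
Local Notation mu := (lebesgue2 R).

Lemma lebesgue_measure_shift (c : R) (A : set T) : measurable A ->
  leb ((fun y : T => y + c : T) @^-1` A) = leb A.
Proof.
move=> mA.
have mf : measurable_fun [set: T] (fun y : T => y + c : T).
  exact: measurable_funD.
apply/esym.
rewrite (@lebesgue_measure_unique R (pushforward leb (fun y : T => y + c : T))) //.
move=> X [[a b] _ <-] /=.
rewrite /pushforward.
have -> : (fun y : T => y + c : T) @^-1` `]a, b]%classic = `]a - c, b - c]%classic.
  by apply/seteqP; split=> x /=; rewrite !in_itv /=; lra.
by rewrite !lebesgue_measure_itv /= !lte_fin ltrD2r; case: ifP => // _; rewrite -!EFinD; congr EFin; lra.
Qed.

Lemma lebesgue2_sections2 (A : set (T * T)) : measurable A ->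
  mu A = (\int[leb]_y leb (ysection A y))%E.
Proof.
move=> mA.
apply: (@product_measure_unique _ _ _ _ _ leb leb (leb \x^ leb)%E) => // B C mB mC.
exact: (product_measure2E leb leb).
Qed.

(** Each vertical section is only translated, by an amount depending on its abscissa. Constant
    shears give translations; a linear one straightens slanted parallelograms. *)
Lemma lebesgue2_shear1 (phi : T -> T) (A : set (T * T)) :
  measurable_fun setT phi -> measurable A ->
  mu ((fun x : T * T => (x.1, x.2 + phi x.1 : T)) @^-1` A) = mu A.
Proof.
move=> mphi mA; apply: eq_integral => x _ /=.
rewrite -(lebesgue_measure_shift (phi x) (measurable_xsection x mA)).
by congr (leb _); apply/seteqP; split => y; rewrite /= /xsection/= !inE.
Qed.

Lemma lebesgue2_shear2 (phi : T -> T) (A : set (T * T)) :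
  measurable_fun setT phi -> measurable A ->
  mu ((fun x : T * T => (x.1 + phi x.2 : T, x.2)) @^-1` A) = mu A.
Proof.
move=> mphi mA.
have mf : measurable_fun [set: T * T] (fun x : T * T => (x.1 + phi x.2 : T, x.2)).
  apply: measurable_fun_pair; last exact: measurable_snd.
  apply: measurable_funD; first exact: measurable_fst.
  by apply: measurableT_comp => //; exact: measurable_snd.
have mB : measurable ((fun x : T * T => (x.1 + phi x.2 : T, x.2)) @^-1` A).
  by rewrite -[X in measurable X]setTI; exact: mf.
rewrite !lebesgue2_sections2 //; apply: eq_integral => y _.
rewrite -(lebesgue_measure_shift (phi y) (measurable_ysection y mA)).
by congr (leb _); apply/seteqP; split => x; rewrite /= /ysection/= !inE.
Qed.

Lemma lebesgue2_translate (v : R * R) (A : set (T * T)) : measurable A ->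
  mu ((fun x : R * R => x + v : R * R) @^-1` A) = mu A.
Proof.
move=> mA.
have mf : measurable_fun [set: T * T] (fun x : T * T => (x.1 + v.1 : T, x.2)).
  apply: measurable_fun_pair; last exact: measurable_snd.
  by apply: measurable_funD; first exact: measurable_fst.
have mB : measurable ((fun x : T * T => (x.1 + v.1 : T, x.2)) @^-1` A).
  by rewrite -[X in measurable X]setTI; exact: mf.
rewrite -(@lebesgue2_shear2 (fun=> v.1) A) //.
by rewrite -(@lebesgue2_shear1 (fun=> v.2) _ _ mB).
Qed.

(** Measurable sets of the plane are generated by rectangles, so an open set is exhibited as the
    countable union of the boxes with rational center and radius that it contains. *)
Lemma open_measurable2 (A : set (R * R)) : open A -> measurable (A : set (T * T)).
Proof.
move=> oA.
pose box (q : rat * rat * rat) : set (R * R) :=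
  [set x | `|x.1 - ratr q.1.1| < ratr q.2 /\ `|x.2 - ratr q.1.2| < ratr q.2].
have -> : A = \bigcup_(q in [set q | box q `<=` A]) box q.
  apply/seteqP; split; last by move=> x [q /= + qx]; apply.
  move=> x Ax; have /nbhs_ballP[e /= e0 eA] := oA x Ax.
  have [r2] : exists q : rat, ratr q \in `]0, (e / 2)[.
    by apply: rat_in_itvoo; lra.
  rewrite in_itv /= => /andP[r0 re].
  have q1P (y : R) : exists q : rat, `|y - ratr q| < ratr r2.
    have [q] : exists q : rat, ratr q \in `](y - ratr r2), (y + ratr r2)[.
      by apply: rat_in_itvoo; lra.
    by rewrite in_itv /= => /andP[? ?]; exists q; rewrite ltr_norml; lra.
  have [q1 hq1] := q1P x.1; have [q2 hq2] := q1P x.2.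
  exists (q1, q2, r2) => //= y /= [y1 y2]; apply: eA; split => /=;
    rewrite /ball /= /ball_; move: hq1 hq2 y1 y2; rewrite !ltr_norml; lra.
rewrite bigcup_mkcond; apply: countable_bigcupT_measurable => [|q].
  exact: countableP.
case: ifP => _ //.
have m1 : measurable_fun [set: T * T] (fun x : T * T => `|x.1 - ratr q.1.1| : R).
  by apply: measurableT_comp => //; apply: measurable_funB.
have m2 : measurable_fun [set: T * T] (fun x : T * T => `|x.2 - ratr q.1.2| : R).
  by apply: measurableT_comp => //; apply: measurable_funB.
have -> : box q = [set x : T * T | (`|x.1 - ratr q.1.1| : R) < ratr q.2] `&`
    [set x : T * T | (`|x.2 - ratr q.1.2| : R) < ratr q.2] by [].
apply: measurableI.
- rewrite [X in measurable X](_ : _ = setT `&` (fun x : T * T => (`|x.1 - ratr q.1.1| < ratr q.2 :> R)) @^-1` [set true]).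
    by apply: measurable_fun_ltr.
  by apply/seteqP; split => x /=; [move=> -> |case].
- rewrite [X in measurable X](_ : _ = setT `&` (fun x : T * T => (`|x.2 - ratr q.1.2| < ratr q.2 :> R)) @^-1` [set true]).
    by apply: measurable_fun_ltr.
  by apply/seteqP; split => x /=; [move=> -> |case].
Qed.

Lemma closed_measurable2 (A : set (R * R)) : closed A -> measurable (A : set (T * T)).
Proof. by move/closed_openC/open_measurable2/measurableC; rewrite setCK. Qed.

Lemma lebesgue_measure_sub_itv (d h : R) (A : set T) : measurable A -> 0 <= h ->
  (forall y, A y -> d <= y <= d + h) -> (leb A <= h%:E)%E.
Proof.
move=> mA h0 hA.
have : (leb A <= leb `[d, (d + h)%R]%classic)%E.
  by apply: le_measure; rewrite ?inE // => y /hA; rewrite /= in_itv.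
move/le_trans; apply; rewrite lebesgue_measure_itv /= lte_fin.
case: ifP => _; last by rewrite lee_fin.
by rewrite -EFinD lee_fin; lra.
Qed.

(** The left end [d] of a slice may vary with [y], which admits slanted parallelograms. *)
Lemma lebesgue2_strip2 (c l h : R) (A : set (T * T)) : measurable A ->
  0 <= l -> 0 <= h -> (forall x, A x -> c <= x.2 <= c + l) ->
  (forall y, exists d, forall x, A (x, y) -> d <= x <= d + h) ->
  (mu A <= (h * l)%:E)%E.
Proof.
move=> mA l0 h0 Al Ah; rewrite lebesgue2_sections2 //.
have mI : measurable (`[c, (c + l)]%classic : set T) by exact: measurable_itv.
have : (\int[leb]_y leb (ysection A y) <=
    \int[leb]_y (h%:E * (\1_(`[c, (c + l)%R]%classic : set T) y)%:E))%E.
  apply: ge0_le_integral => //.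
  - exact: measurable_fun_ysection.
  - by apply: emeasurable_funM => //; apply/measurable_EFinP.
  - move=> y _; rewrite indicE; case: (asboolP (`[c, (c + l)]%classic y)) => yI.
      rewrite mem_set // mule1.
      have [d hd] := Ah y.
      apply: (@lebesgue_measure_sub_itv d) => //; first exact: measurable_ysection.
      by move=> x; rewrite /ysection /= inE => /hd.
    rewrite memNset // mule0 (_ : ysection A y = set0) ?measure0 //.
    apply/seteqP; split => x //; rewrite /ysection /= inE => /Al /= h1.
    by apply: yI; rewrite /= in_itv.
move/le_trans; apply.
rewrite ge0_integralZl //; last by apply/measurable_EFinP.
  by rewrite integral_indic // setIT EFinM; apply: lee_wpmul2l => //;
    apply: (@lebesgue_measure_sub_itv c) => // y; rewrite /= in_itv.
Qed.

Lemma lebesgue2_strip1 (c l h : R) (A : set (T * T)) : measurable A ->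
  0 <= l -> 0 <= h -> (forall x, A x -> c <= x.1 <= c + l) ->
  (forall x, exists d, forall y, A (x, y) -> d <= y <= d + h) ->
  (mu A <= (h * l)%:E)%E.
Proof.
move=> mA l0 h0 Al Ah.
have mI : measurable (`[c, (c + l)]%classic : set T) by exact: measurable_itv.
have : (\int[leb]_x leb (xsection A x) <=
    \int[leb]_y (h%:E * (\1_(`[c, (c + l)%R]%classic : set T) y)%:E))%E.
  apply: ge0_le_integral => //.
  - exact: measurable_fun_xsection.
  - by apply: emeasurable_funM => //; apply/measurable_EFinP.
  - move=> y _; rewrite indicE; case: (asboolP (`[c, (c + l)]%classic y)) => yI.
      rewrite mem_set // mule1.
      have [d hd] := Ah y.
      apply: (@lebesgue_measure_sub_itv d) => //; first exact: measurable_xsection.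
      by move=> x; rewrite /xsection /= inE => /hd.
    rewrite memNset // mule0 (_ : xsection A y = set0) ?measure0 //.
    apply/seteqP; split => x //; rewrite /xsection /= inE => /Al /= h1.
    by apply: yI; rewrite /= in_itv.
move/le_trans; apply.
rewrite ge0_integralZl //; last by apply/measurable_EFinP.
  by rewrite integral_indic // setIT EFinM; apply: lee_wpmul2l => //;
    apply: (@lebesgue_measure_sub_itv c) => // y; rewrite /= in_itv.
Qed.


Lemma continuous_affine2 (al be ga : R) :
  continuous (fun x : R * R => al * x.1 + be * x.2 + ga : R).
Proof.
move=> x; apply: cvgD; last exact: cvg_cst.
apply: cvgD; apply: cvgM; try exact: cvg_cst.
- exact: cvg_fst.
- exact: cvg_snd.
Qed.

Lemma open_affine2_gt (al be ga : R) : open [set x : R * R | 0 < al * x.1 + be * x.2 + ga].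
Proof. by apply: open_comp (@open_gt R 0) => // x _; apply: continuous_affine2. Qed.

Lemma lebesgue2_line (al be ga : R) : (al != 0) || (be != 0) ->
  mu [set x : R * R | al * x.1 + be * x.2 + ga = 0] = 0%E.
Proof.
move=> ab.
have mL : measurable ([set x : R * R | al * x.1 + be * x.2 + ga = 0] : set (T * T)).
  apply: closed_measurable2.
  apply: closed_comp (@closed_eq R 0) => x _; exact: continuous_affine2.
have [b0|b0] := eqVneq be 0.
  rewrite b0 eqxx orbF in ab.
  rewrite lebesgue2_sections2 //; apply: integral0_eq => y _.
  apply: (@subset_measure0 _ _ _ leb _ [set - ga / al]) => //.
  - exact: measurable_ysection.
  - move=> x; rewrite /ysection /= inE /= b0 mul0r addr0 => h.
    by rewrite -(mulKf ab x) mulrC; congr (_ / _); lra.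
  - exact: lebesgue_measure_set1.
apply: integral0_eq => x _ /=.
apply: (@subset_measure0 _ _ _ leb _ [set (- ga - al * x) / be]) => //.
- exact: measurable_xsection.
- move=> y; rewrite /xsection /= inE /= => h.
  by rewrite -(mulKf b0 y) mulrC; congr (_ / _); lra.
- exact: lebesgue_measure_set1.
Qed.

Definition det (v w : R * R) : R := v.1 * w.2 - v.2 * w.1.

(* Solves [x + t eta = a + s e] by Cramer's rule; junk when [eta] is parallel to [e]. *)
Definition cross_time (a e eta x : R * R) : R := det e (a - x) / det e eta.
Definition cross_abs (a e eta x : R * R) : R := det (x - a) eta / det e eta.

(** The starting points [x] for which the segment from [x] to [x + eta] crosses the edge from [a] to
    [a + e]: an open parallelogram spanned by [e] and [- eta], empty when these are parallel, since
    [cross_abs] is then 0. *)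
Definition cross_set (a e eta : R * R) : set (R * R) :=
  [set x | 0 < cross_abs a e eta x < 1 /\ 0 < cross_time a e eta x < 1].

Lemma open_cross_set a e eta : open (cross_set a e eta).
Proof.
set d := (det e eta)^-1.
have -> : cross_set a e eta =
  [set x : R * R | 0 < (d * eta.2) * x.1 + (- (d * eta.1)) * x.2 + d * (a.2 * eta.1 - a.1 * eta.2)] `&`
  [set x : R * R | 0 < (- (d * eta.2)) * x.1 + (d * eta.1) * x.2 + (1 - d * (a.2 * eta.1 - a.1 * eta.2))] `&`
  ([set x : R * R | 0 < (d * e.2) * x.1 + (- (d * e.1)) * x.2 + d * (a.2 * e.1 - a.1 * e.2)] `&`
  [set x : R * R | 0 < (- (d * e.2)) * x.1 + (d * e.1) * x.2 + (1 - d * (a.2 * e.1 - a.1 * e.2))]).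
  apply/seteqP; split => x; rewrite /cross_set /cross_time /cross_abs /= -/d /det /=;
    by rewrite -!(rwP andP); split; lra.
by do !apply: openI; exact: open_affine2_gt.
Qed.

Lemma affine_preimage_itv (w b : R) : w != 0 ->
  exists d, forall y, 0 < w * y + b < 1 -> d <= y <= d + `|w^-1|.
Proof.
move=> w0; case: (ltrgt0P w) w0 => // ws _.
- have wi : 0 < w^-1 by rewrite invr_gt0.
  exists (- b * w^-1) => y; rewrite gtr0_norm // => /andP[h1 h2].
  have yE : y = (w * y + b) * w^-1 - b * w^-1 by field; rewrite gt_eqF.
  by rewrite yE; nra.
- have wi : w^-1 < 0 by rewrite invr_lt0.
  exists ((1 - b) * w^-1) => y; rewrite ltr0_norm // => /andP[h1 h2].
  have yE : y = (w * y + b) * w^-1 - b * w^-1 by field; rewrite lt_eqF.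
  by rewrite yE; nra.
Qed.

(** A shear makes [eta] horizontal; the slices along it then have length [|eta.1|] and the height is
    [|det e eta / eta.1|]. For a vertical [eta], vertical slices are used directly. *)
Lemma lebesgue2_cross_set (a e eta : R * R) :
  (mu (cross_set a e eta) <= `|det e eta|%:E)%E.
Proof.
have [d0|d0] := eqVneq (det e eta) 0.
  rewrite d0 normr0 (_ : cross_set _ _ _ = set0) ?measure0 //.
  by apply/seteqP; split => x //; rewrite /cross_set /= /cross_abs d0 invr0 mulr0 ltxx => -[].
have mQ : measurable (cross_set a e eta : set (T * T)).
  by apply: open_measurable2; exact: open_cross_set.
have [e0|e0] := eqVneq eta.1 0.
  have e20 : eta.2 != 0.
    by apply: contra_neq d0 => h; rewrite /det e0 h; ring.
  have e10 : e.1 != 0.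
    by apply: contra_neq d0 => h; rewrite /det e0 h; ring.
  have [c hc] := @affine_preimage_itv (eta.2 / det e eta) (- a.1 * eta.2 / det e eta) ltac:(by rewrite mulf_neq0 ?invr_eq0).
  have Hc x : cross_set a e eta x -> c <= x.1 <= c + `|(eta.2 / det e eta)^-1|.
    move=> [h _]; apply: hc.
    suff -> : eta.2 / det e eta * x.1 + - a.1 * eta.2 / det e eta = cross_abs a e eta x by [].
    by rewrite /cross_abs /det /= e0; field; apply/andP; split.
  have Hd x : exists d, forall y, cross_set a e eta (x, y) -> d <= y <= d + `|eta.2|.
    have [d hd] := @affine_preimage_itv (- eta.2^-1) (det e (a - (x, 0)) / det e eta) ltac:(by rewrite oppr_eq0 invr_eq0).
    exists d => y [_ h]; rewrite -[eta.2]invrK -normrN -invrN; apply: hd.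
    suff -> : - eta.2^-1 * y + det e (a - (x, 0)) / det e eta = cross_time a e eta (x, y) by [].
    by rewrite /cross_time /det /= e0; field; apply/andP; split.
  apply: le_trans (lebesgue2_strip1 mQ _ _ Hc Hd) _ => //.
  by rewrite -normrM lee_fin; rewrite le_eqVlt; apply/orP; left; apply/eqP; congr `|_|; field; apply/andP; split.
pose m := eta.2 / eta.1.
have mphi : measurable_fun [set: T] (fun t : T => m * t : T).
  exact: mulrl_measurable.
rewrite -(lebesgue2_shear1 mphi mQ); set B := _ @^-1` _.
have mf : measurable_fun [set: T * T] (fun x : T * T => (x.1, x.2 + m * x.1 : T)).
  apply: measurable_fun_pair; first exact: measurable_fst.
  apply: measurable_funD; first exact: measurable_snd.
  by apply: measurableT_comp => //; exact: measurable_fst.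
have mB : measurable B by rewrite -[X in measurable X]setTI; exact: mf.
have [c hc] := @affine_preimage_itv (- eta.1 / det e eta) ((a.2 - m * a.1) * eta.1 / det e eta) ltac:(by rewrite mulf_neq0 ?oppr_eq0 ?invr_eq0).
have Hc x : B x -> c <= x.2 <= c + `|(- eta.1 / det e eta)^-1|.
  move=> [h _]; apply: hc; move: h.
  suff -> : - eta.1 / det e eta * x.2 + ((a.2 - m * a.1) * eta.1 / det e eta) = cross_abs a e eta (x.1, x.2 + m * x.1) by [].
  by rewrite /cross_abs /m /det /=; field; apply/andP; split.
have Hd y : exists d, forall x, B (x, y) -> d <= x <= d + `|eta.1|.
  have [d hd] := @affine_preimage_itv (- eta.1^-1) (det e (a - (0, y)) / det e eta) ltac:(by rewrite oppr_eq0 invr_eq0).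
  exists d; move=> z [_ h]; rewrite -[eta.1]invrK -normrN -invrN; apply: hd.
  suff -> : - eta.1^-1 * z + det e (a - (0, y)) / det e eta = cross_time a e eta (z, y + m * z) by [].
  by rewrite /cross_time /det /m /=; field; apply/andP; split.
apply: le_trans (lebesgue2_strip2 mB _ _ Hc Hd) _ => //.
by rewrite -normrM lee_fin; rewrite le_eqVlt; apply/orP; left; apply/eqP; rewrite -normrN; congr `|_|; field; apply/andP; split.
Qed.
End PlaneMeasure.

(** * Convex sets and segments *)

Section Plane.
Context {R : realType}.
Implicit Types (A K : set (R * R)) (a b x y z : R * R).

Lemma nbhs2P x A : nbhs x A <->
  exists2 e : R, 0 < e & forall y, `|y.1 - x.1| < e -> `|y.2 - x.2| < e -> A y.
Proof.
rewrite nbhs_ballP; split=> -[e e0 eA]; exists e => // y.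
  move=> h1 h2; apply: eA; split; rewrite /ball /= /ball_ distrC //.
by move=> [h1 h2]; apply: eA; rewrite distrC.
Qed.

Lemma closure2P x A : closure A x <->
  forall e : R, 0 < e -> exists y, [/\ A y, `|y.1 - x.1| < e & `|y.2 - x.2| < e].
Proof.
split=> [cx e e0|h B /nbhs2P[e e0 eB]].
  have /cx[y [Ay [h1 h2]]] : nbhs x [set y | `|y.1 - x.1| < e /\ `|y.2 - x.2| < e].
    by apply/nbhs2P; exists e.
  by exists y.
by have [y [Ay h1 h2]] := h _ e0; exists y; split => //; exact: eB.
Qed.

Lemma eq_pair2 x y : x.1 = y.1 -> x.2 = y.2 -> x = y.
Proof. by case: x y => ? ? [? ?] /= -> ->. Qed.

Lemma convex_segment A x y (t : R) : convex_set A -> A x -> A y -> 0 <= t <= 1 ->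
  A (x + t *: (y - x)).
Proof.
move=> cA Ax Ay /andP[t0 t1].
have := cA y x (Itv01 t0 t1); rewrite !inE => /(_ Ay Ax).
set z := (X in A X -> _); suff -> : z = x + t *: (y - x) by [].
by apply: eq_pair2; rewrite /z /= /GRing.scale /= /unstable.onem; ring.
Qed.

Lemma norm_conv_lt (u v e t : R) : 0 <= t <= 1 -> `|u| < e -> `|v| < e ->
  `|(1 - t) * u + t * v| < e.
Proof.
move=> /andP[t0 t1] ue ve; apply: le_lt_trans (ler_normD _ _) _.
rewrite !normrM (ger0_norm t0) ger0_norm ?subr_ge0 //.
have [->|tn] := eqVneq t 0; first by rewrite subr0 mul0r mul1r addr0.
have tp : 0 < t by rewrite lt_def tn.
have : t * `|v| < t * e by rewrite ltr_pM2l.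
have : (1 - t) * `|u| <= (1 - t) * e by apply: ler_wpM2l; [lra|exact: ltW].
lra.
Qed.

Lemma convex_closure A x y (t : R) : convex_set A -> closure A x -> closure A y ->
  0 <= t <= 1 -> closure A (x + t *: (y - x)).
Proof.
move=> cA /closure2P cx /closure2P cy t01; apply/closure2P => e e0.
have [x' [Ax x1 x2]] := cx _ e0; have [y' [Ay y1 y2]] := cy _ e0.
exists (x' + t *: (y' - x')); split; first exact: convex_segment.
- rewrite /= /GRing.scale /= (_ : _ - _ = (1 - t) * (x'.1 - x.1) + t * (y'.1 - y.1)); last by ring.
  exact: norm_conv_lt.
- rewrite /= /GRing.scale /= (_ : _ - _ = (1 - t) * (x'.2 - x.2) + t * (y'.2 - y.2)); last by ring.
  exact: norm_conv_lt.
Qed.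

Lemma open_convex_segment K x y (t : R) : open K -> convex_set K ->
  K x -> closure K y -> 0 <= t < 1 -> K (x + t *: (y - x)).
Proof.
move=> oK cK Kx /closure2P cy /andP[t0 t1].
have /nbhs2P[e e0 eK] := oK x Kx.
have d0 : 0 < e * (1 - t) by apply: mulr_gt0 => //; lra.
have [y' [Ky y1 y2]] := cy _ d0.
set z := x + t *: (y - x).
(* Shifting [x] compensates the replacement of [y] by the nearby point [y'] of [K]: [z] divides the
   new segment in the same ratio. The factor [1 - t] in the tolerance keeps [x'] in the box of size
   [e]. *)
pose x' := x + (t / (1 - t)) *: (y - y').
have ht : 0 <= t / (1 - t) by apply: divr_ge0 => //; lra.
have ht1 : 1 - t != 0 by rewrite gt_eqF //; lra.
have bnd u : `|u| < e * (1 - t) -> `|t / (1 - t) * u| < e.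
  move=> hu; rewrite normrM ger0_norm //.
  have hu1 : `|u| / (1 - t) < e by rewrite ltr_pdivrMr //; lra.
  apply: le_lt_trans hu1; rewrite mulrAC; apply: ler_wpM2r.
    by rewrite invr_ge0; lra.
  by apply: ler_piMl => //; exact: ltW.
have Kx' : K x'.
  apply: eK; rewrite /x' /= /GRing.scale /= addrC addKr; apply: bnd; by rewrite distrC.
have -> : z = x' + t *: (y' - x').
  by apply: eq_pair2; rewrite /z /x' /= /GRing.scale /=; field.
by apply: convex_segment => //; lra.
Qed.

Lemma closed_cseg a b : closed (cseg a b).
Proof.
apply: compact_closed; first exact: norm_hausdorff.
apply: (@continuous_compact _ _ (fun t : R => a + t *: (b - a)) `[0, 1]%classic).
  apply: continuous_subspaceT => t; apply: cvgD; first exact: cvg_cst.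
  by apply: cvgZl.
exact: segment_compact.
Qed.

Lemma closure_oseg a b : closure (oseg a b) `<=` cseg a b.
Proof.
rewrite closureE => x; apply; split; first exact: closed_cseg.
by move=> _ [t /= h <-]; exists t => //=; lra.
Qed.

Lemma zero_length_subset A B : A `<=` B -> zero_length B -> zero_length A.
Proof.
by move=> AB zB e /zB[c [rad [h1 h2 h3]]]; exists c, rad; split => // x /AB/h2.
Qed.

Lemma enorm_ge (x : R * R) : `|x.1| <= enorm x /\ `|x.2| <= enorm x.
Proof.
by rewrite /enorm /dot -!sqrtr_sqr; split; apply: ler_wsqrtr; rewrite expr2; nra.
Qed.

(* Projecting a cover by discs to a coordinate axis covers an interval. *)
Lemma zero_length_oseg a b : zero_length (oseg a b) -> a = b.
Proof.
move=> zl; apply/eqP; apply: contraT => ab.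
have [f [fL fc fab]] : exists f : R * R -> R, [/\ forall t : R, f (a + t *: (b - a)) = f a + t * (f b - f a),
    forall (x c : R * R), `|f x - f c| <= enorm (x - c) & f a != f b].
  have [a1|a1] := eqVneq a.1 b.1.
    exists snd; split => //; first by move=> x c; exact: (enorm_ge (x - c)).2.
    by apply: contra ab => /eqP a2; apply/eqP/eq_pair2.
  by exists fst; split => //; move=> x c; exact: (enorm_ge (x - c)).1.
pose l := `|f b - f a|.
have l0 : 0 < l by rewrite normr_gt0 subr_eq0 eq_sym.
have [c [rad [r0 cov sm]]] := zl (l / 4) ltac:(lra).
pose lo := Num.min (f a) (f b).
have : (@lebesgue_measure R `]lo, (lo + l)%R[%classic <=
   \sum_(0 <= i <oo) @lebesgue_measure R `[(f (c i) - rad i)%R, (f (c i) + rad i)%R]%classic)%E.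
  apply: measure_sigma_subadditive => //.
  - move=> y; rewrite /= in_itv /= => /andP[y1 y2].
    have [t t01 ty] : exists2 t : R, 0 < t < 1 & y = f a + t * (f b - f a).
      have fne : f b - f a != 0 by rewrite subr_eq0 eq_sym.
      exists ((y - f a) / (f b - f a)); last by rewrite divfK //; ring.
      move: y1 y2 fne; rewrite /lo /l; case: (ltrgtP (f a) (f b)) fab => // h _.
      - move=> y1 y2 _.
        by rewrite divr_gt0 ?subr_gt0 //= ltr_pdivrMr ?subr_gt0 //; lra.
      - move=> y1 y2 _.
        rewrite -mulrNN -invrN divr_gt0 ?oppr_gt0 ?subr_lt0 //=; [|lra].
        by rewrite ltr_pdivrMr ?oppr_gt0 ?subr_lt0 //; lra.
    have [i _ hi] := cov (a + t *: (b - a)) ltac:(by exists t).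
    exists i => //=; rewrite in_itv /= ty -fL.
    have := le_trans (fc _ _) hi; rewrite ler_norml; lra.
rewrite lebesgue_measure_itv /= lte_fin ltrDl l0 -EFinD (addrC lo) addrK.
have -> : (\sum_(0 <= i <oo) @lebesgue_measure R `[(f (c i) - rad i)%R, (f (c i) + rad i)%R]%classic)%E =
    (\sum_(0 <= i <oo) (2%:E * (rad i)%:E))%E.
  apply: eq_eseriesr => i _; rewrite lebesgue_measure_itv /= lte_fin.
  case: ltP => h; first by rewrite -EFinB -EFinM; congr EFin; ring.
  by rewrite -EFinM; congr EFin; have := r0 i; lra.
rewrite nneseriesZl; last by move=> i _; rewrite lee_fin.
move=> h; have : (l%:E <= 2%:E * (l / 4)%:E)%E.
  by apply: (le_trans h); apply: lee_wpmul2l => //; rewrite lee_fin.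
by rewrite -EFinM lee_fin => hh; exfalso; lra.
Qed.
End Plane.

Section Segments.
Context {R : realType}.
Implicit Types (a b e x y z eta : R * R).

Lemma cseg_oseg a b z : cseg a b z -> z != a -> z != b -> oseg a b z.
Proof.
move=> [t /= /andP[t0 t1] <-] za zb; exists t => //=; rewrite !lt_def t0 t1 !andbT.
apply/andP; split.
  by apply: contra za => /eqP ->; rewrite scale0r addr0.
by apply: contra zb => /eqP <-; rewrite scale1r addrCA subrr addr0.
Qed.

Lemma det_line a e x : e != 0 -> det e (x - a) = 0 -> exists t, x = a + t *: e.
Proof.
rewrite /det /= => e0 d0; have [e1|e1] := eqVneq e.1 0.
  have e2 : e.2 != 0.
    by apply: contra e0 => /eqP e2; apply/eqP/eq_pair2.
  exists ((x.2 - a.2) / e.2); apply: eq_pair2; rewrite /= /GRing.scale /=; last by field.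
  have : e.2 * (x.1 - a.1) = 0 by rewrite -[RHS]oppr0 -d0 e1; ring.
  by move/eqP; rewrite mulf_eq0 (negbTE e2) /= e1 => /eqP h; lra.
exists ((x.1 - a.1) / e.1); apply: eq_pair2; rewrite /= /GRing.scale /=; first by field.
apply: (mulfI e1); rewrite mulrDr mulrCA mulrA mulfVK //; first by lra.
Qed.

Lemma oseg_avoid a e (ps : seq (R * R)) : e != 0 ->
  exists2 d : R, 0 < d & forall t, 0 < t < d -> a + t *: e \notin ps.
Proof.
move=> e0; elim: ps => [|p ps [d d0 hd]]; first by exists 1.
have [[u u0 pE]|np] := pselect (exists2 u : R, 0 < u & p = a + u *: e); last first.
  exists d => // t td; rewrite inE negb_or hd // andbT.
  by apply: contra_notN np => /eqP <-; exists t => //; lra.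
exists (Num.min d u); first by rewrite lt_min d0.
move=> t; rewrite lt_min inE => /andP[t0 /andP[td tu]].
rewrite negb_or hd ?t0 // andbT pE (inj_eq (addrI _)).
rewrite -subr_eq0 -scalerBl scaler_eq0 (negbTE e0) orbF subr_eq0.
by apply/eqP => ?; lra.
Qed.

Lemma oseg_not_in a b (ps : seq (R * R)) : a != b ->
  exists2 z, oseg a b z & z \notin ps.
Proof.
move=> ab; have e0 : b - a != 0 by rewrite subr_eq0 eq_sym.
have [d d0 hd] := oseg_avoid a ps e0.
have m0 : 0 < Num.min d 1 by rewrite lt_min d0 ltr01.
have md : Num.min d 1 <= d by rewrite ge_min lexx.
have m1 : Num.min d 1 <= 1 by rewrite ge_min lexx orbT.
exists (a + (Num.min d 1 / 2) *: (b - a)); last by apply: hd; lra.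
by exists (Num.min d 1 / 2) => //=; lra.
Qed.

(** Binet-Cauchy identity with one product killed by orthogonality; it reads the sign of [dot eta w]
    off the sides of a line along [e]. *)
Lemma dot_det e w eta : dot w e = 0 -> dot eta w * dot e e = det e w * det e eta.
Proof.
move=> h; have -> : det e w * det e eta = dot eta w * dot e e - dot w e * dot eta e.
  by rewrite /dot /det; ring.
by rewrite h mul0r subr0.
Qed.

Lemma enorm2 (x : R * R) : enorm x ^+ 2 = dot x x.
Proof. by rewrite sqr_sqrtr // /dot addr_ge0 // -expr2 sqr_ge0. Qed.

Lemma enorm_gt0 (x : R * R) : x != 0 -> 0 < enorm x.
Proof.
move=> x0; rewrite sqrtr_gt0 /dot; case: (eqVneq x.1 0) => x1; last first.
  by rewrite ltr_pwDl // -expr2 ?sqr_ge0 // exprn_even_gt0.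
rewrite x1 mul0r add0r -expr2 exprn_even_gt0 //=.
by apply: contra x0 => /eqP x2; apply/eqP/eq_pair2.
Qed.

(** For an edge vector [e] and the vector [w] between two centers, the left side is the
    Cauchy-Schwarz weight of the edge. Through this identity the orthogonality condition on the mesh
    makes the weights telescope. *)
Lemma dot_orth e w eta : e != 0 -> dot w e = 0 ->
  enorm w * `|det e eta| / enorm e = `|dot eta w|.
Proof.
move=> e0 we; have n0 := enorm_gt0 e0.
have dw : `|det e w| = enorm w * enorm e.
  apply/eqP; rewrite -(@eqrXn2 _ 2) ?mulr_ge0 ?sqrtr_ge0 //; apply/eqP.
  rewrite -normrX exprMn !enorm2 ger0_norm ?sqr_ge0 // expr2.
  by rewrite -(dot_det _ we) mulrC /dot; ring.
have n2 : enorm e != 0 by rewrite gt_eqF.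
apply: (mulIf n2); rewrite divfK //; apply: (mulIf n2).
rewrite -[RHS]mulrA -expr2 enorm2 mulrAC -dw -normrM -dot_det // normrM.
by congr (_ * _); rewrite ger0_norm // /dot addr_ge0 // -expr2 sqr_ge0.
Qed.

End Segments.

(** * Local geometry of an admissible mesh *)

Section MeshLocal.
Context {R : realType} {M : mesh R} {Om GD GN : set (R * R)}.
Hypothesis adm : admissible M Om GD GN.
Implicit Types (K L : cell M) (s : edge M) (x y z eta : R * R).

Definition edge_vec s : R * R := end2 s - end1 s.
Definition edge_side s x : R := det (edge_vec s) (x - end1 s).

Lemma open_cell K : open (cellset K).
Proof. exact: cell_open adm _. Qed.

Lemma convex_cell K : convex_set (cellset K).
Proof. exact: cell_convex adm _. Qed.

Lemma edge_vec_neq0 s : edge_vec s != 0.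
Proof. by rewrite subr_eq0 eq_sym (edge_nondeg adm). Qed.

Lemma edge_side_affine s x eta (t : R) :
  edge_side s (x + t *: eta) = edge_side s x + t * det (edge_vec s) eta.
Proof. by rewrite /edge_side /det /= /GRing.scale /=; ring. Qed.

Lemma edge_side_cseg s z : cseg (end1 s) (end2 s) z -> edge_side s z = 0.
Proof.
by move=> [t _ <-]; rewrite /edge_side /edge_vec /det /= /GRing.scale /=; ring.
Qed.

Lemma edgeset_cseg s : edgeset s `<=` cseg (end1 s) (end2 s).
Proof. by move=> _ [t /= h <-]; exists t => //=; lra. Qed.

Lemma cell_closure_disjoint K L x : K != L -> cellset K x -> ~ closure (cellset L) x.
Proof.
move=> KL Kx /(_ _ (open_nbhs_nbhs (conj (open_cell (K:=K)) Kx)))[y [Ly Ky]].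
by have := cell_disjoint adm KL; rewrite -subset0 => /(_ y (conj Ky Ly)).
Qed.

Lemma cell_unique K L x : cellset K x -> cellset L x -> K = L.
Proof.
move=> Kx Lx; apply/eqP; apply: contraT => KL.
by case: (cell_closure_disjoint KL Kx (@subset_closure _ _ _ Lx)).
Qed.

Lemma boundary_cell K x : boundary (cellset K) x <-> closure (cellset K) x /\ ~ cellset K x.
Proof. by rewrite /boundary; have /interior_id -> := @open_cell K. Qed.

Lemma edge_boundary K s z : s \in edges_of K -> closure (edgeset s) z ->
  closure (cellset K) z /\ ~ cellset K z.
Proof.
move=> sK sz; apply/boundary_cell; rewrite (cell_boundary adm).
by exists s.
Qed.

Lemma edge_not_cell s z K : closure (edgeset s) z -> ~ cellset K z.
Proof.
move=> sz Kz; have [L sL] := edge_used adm s.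
have [cL nL] := edge_boundary sL sz.
have [KL|KL] := eqVneq K L; first by rewrite KL in Kz.
exact: cell_closure_disjoint KL Kz cL.
Qed.

Lemma cell_boundary_edge K x : closure (cellset K) x -> ~ cellset K x ->
  exists2 s, s \in edges_of K & cseg (end1 s) (end2 s) x.
Proof.
move=> cx nx; have : boundary (cellset K) x by apply/boundary_cell.
by rewrite (cell_boundary adm) => -[s /= sK /closure_oseg]; exists s.
Qed.

(** A point of [K] on the line carrying [s] could be joined to a point of the edge; another edge
    point strictly in between would belong to the open convex cell, whereas edges lie on its
    boundary. *)
Lemma edge_side_cell_neq0 K s x : s \in edges_of K -> cellset K x -> edge_side s x != 0.
Proof.
move=> sK Kx; apply/eqP => /(det_line (edge_vec_neq0 s))[t xE].
pose p (u : R) := end1 s + u *: edge_vec s.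
have pK (u : R) : 0 < u < 1 -> closure (cellset K) (p u) /\ ~ cellset K (p u).
  by move=> u01; apply: edge_boundary sK _; apply: subset_closure; exists u.
have key (u w th : R) : 0 < u < 1 -> 0 < w < 1 -> 0 <= th < 1 ->
    u = t + th * (w - t) -> False.
  move=> u01 w01 th01 uE; have [_] := pK u u01; apply.
  have -> : p u = x + th *: (p w - x).
    rewrite xE /p; apply: eq_pair2; rewrite /= /GRing.scale /= uE; ring.
  apply: open_convex_segment => //; first exact: open_cell.
    exact: convex_cell.
  by have [] := pK w w01.
have [t0|t0] := leP t 0.
  (* Here [x] lies before the edge, and the edge point of parameter 1/4 is between [x] and that of
     parameter 1/2. Past the edge, 3/4 replaces 1/4. *)
  have h : 0 < 1 / 2 - t by lra.
  have tn : 1 / 2 - t != 0 by rewrite gt_eqF.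
  apply: (@key (1 / 4) (1 / 2) ((1 / 4 - t) / (1 / 2 - t))); try lra.
    by rewrite divr_ge0 /= ?ltr_pdivrMr //; lra.
  by field; rewrite -mulr_natl; move: tn; apply: contra => /eqP ?; apply/eqP; lra.
have [t1|t1] := ltP t 1.
  apply: (@edge_not_cell s x K) => //; apply: subset_closure; exists t => //=.
  by rewrite t0 t1.
have h : 0 < t - 1 / 2 by lra.
have tn : t - 1 / 2 != 0 by rewrite gt_eqF.
apply: (@key (3 / 4) (1 / 2) ((t - 3 / 4) / (t - 1 / 2))); try lra.
  by rewrite divr_ge0 /= ?ltr_pdivrMr //; lra.
by rewrite -[1 / 2 - t]opprB mulrN divfK //; lra.
Qed.

(** An affine function without zeros on a convex set keeps its sign; [t] locates the zero that a
    change of sign would produce. *)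
Lemma edge_side_cell K s x y : s \in edges_of K -> cellset K x -> cellset K y ->
  0 < edge_side s x * edge_side s y.
Proof.
move=> sK Kx Ky; rewrite ltNge; apply/negP => h.
have xn := edge_side_cell_neq0 sK Kx; have yn := edge_side_cell_neq0 sK Ky.
have d0 : edge_side s x - edge_side s y != 0.
  apply/eqP => d; have xy : edge_side s x = edge_side s y by lra.
  move: h; rewrite xy -expr2 le_eqVlt ltNge sqr_ge0 orbF sqrf_eq0.
  by rewrite (negbTE yn).
pose t := edge_side s x / (edge_side s x - edge_side s y).
have t01 : 0 <= t <= 1.
  have d2 : 0 < (edge_side s x - edge_side s y) ^+ 2 by rewrite lt_def sqrf_eq0 d0 sqr_ge0.
  have -> : t = edge_side s x * (edge_side s x - edge_side s y) / (edge_side s x - edge_side s y) ^+ 2.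
    by rewrite /t; field.
  rewrite divr_ge0 ?ler_pdivrMr ?(ltW d2) //=; last by have := sqr_ge0 (edge_side s x); nra.
  by have := sqr_ge0 (edge_side s y); nra.
have := edge_side_cell_neq0 sK (convex_segment (@convex_cell K) Kx Ky t01).
rewrite edge_side_affine => /eqP; apply.
have -> : det (edge_vec s) (y - x) = - (edge_side s x - edge_side s y).
  by rewrite /edge_side /det /=; ring.
by rewrite mulrN divfK // subrr.
Qed.

Lemma edge_side_closure K s x y : s \in edges_of K -> cellset K x -> closure (cellset K) y ->
  0 <= edge_side s x * edge_side s y.
Proof.
move=> sK Kx Ky; rewrite leNgt; apply/negP => h.
have xn := edge_side_cell_neq0 sK Kx.
have x2 : 0 < edge_side s x ^+ 2 by rewrite lt_def sqrf_eq0 xn sqr_ge0.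
have d0 : 0 < edge_side s x * (edge_side s x - edge_side s y) by rewrite mulrBr -expr2; lra.
have dn : edge_side s x - edge_side s y != 0.
  by apply: contraTneq d0 => ->; rewrite mulr0 ltxx.
pose t := edge_side s x ^+ 2 / (edge_side s x * (edge_side s x - edge_side s y)).
have t01 : 0 <= t < 1.
  by rewrite divr_ge0 ?ltr_pdivrMr ?ltW //= mul1r mulrBr -expr2; lra.
have Kz := open_convex_segment (@open_cell K) (@convex_cell K) Kx Ky t01.
have := edge_side_cell_neq0 sK Kz.
rewrite edge_side_affine => /eqP; apply.
have -> : det (edge_vec s) (y - x) = - (edge_side s x - edge_side s y).
  by rewrite /edge_side /det /=; ring.
by rewrite /t; field; rewrite xn dn.
Qed.

(* A ray from a point of an edge, pointing to the side of the cell, starts in the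
   triangle spanned by the edge and the center. *)
Lemma edge_ray K s z eta : s \in edges_of K -> edgeset s z ->
  0 < det (edge_vec s) eta * edge_side s (center K) ->
  exists2 d : R, 0 < d & forall t, 0 < t < d -> cellset K (z + t *: eta).
Proof.
move=> sK sz hp; set x := center K; set e := edge_vec s.
have Kx : cellset K x := center_in adm K.
have xn := edge_side_cell_neq0 sK Kx.
have zs : edge_side s z = 0 by exact/edge_side_cseg/edgeset_cseg.
have exz : det e (x - z) = edge_side s x.
  by rewrite -[LHS]addr0 -zs /edge_side /det /=; ring.
pose al := det e eta / edge_side s x.
have al0 : 0 < al.
  have -> : al = det e eta * edge_side s x / edge_side s x ^+ 2 by rewrite /al; field.
  by rewrite divr_gt0 // lt_def sqrf_eq0 xn sqr_ge0.
have [be beE] : exists be, eta = al *: (x - z) + be *: e.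
  have [be hbe] := @det_line R (al *: (x - z)) e eta (edge_vec_neq0 s) ltac:(
    rewrite (_ : det e _ = det e eta - al * det e (x - z));
      [by rewrite exz /al divfK ?subrr|rewrite /det /= /GRing.scale /=; ring]).
  by exists be.
have [u /= u01 zE] := sz.
pose m := Num.min u (1 - u).
have m0 : 0 < m by rewrite lt_min; lra.
have mu1 : m <= u by rewrite ge_min lexx.
have mu2 : m <= 1 - u by rewrite ge_min lexx orbT.
have b1 : 0 < `|be| + 1 by rewrite ltr_wpDl.
exists (Num.min (1 / (2 * al)) (m / (2 * (`|be| + 1)))).
  by rewrite lt_min !divr_gt0 //; lra.
move=> t; rewrite lt_min => /andP[t0 /andP[]].
rewrite ltr_pdivlMr; last lra.
rewrite ltr_pdivlMr; last lra.
move=> h1 h2; pose th := t * al.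
have th1 : 0 < th < 1 / 2 by rewrite /th mulr_gt0 //=; lra.
pose mm := t * be / (1 - th).
have thn : 1 - th != 0 by rewrite gt_eqF //; lra.
have mm1 : `|mm| < m.
  rewrite /mm normrM normfV normrM (gtr0_norm t0) (gtr0_norm (_ : 0 < 1 - th)); last lra.
  rewrite ltr_pdivrMr; last lra.
  have : m * (1 / 2) <= m * (1 - th) by rewrite ler_pM2l //; lra.
  have hE : t * (2 * (`|be| + 1)) = 2 * (t * `|be|) + 2 * t by ring.
  by rewrite hE in h2; lra.
pose y := z + mm *: e.
have sy : closure (edgeset s) y.
  apply: subset_closure; exists (u + mm) => /=; first by move: mm1; rewrite ltr_norml; lra.
  by rewrite /y -zE; apply: eq_pair2; rewrite /= /GRing.scale /=; ring.
have [Ky _] := edge_boundary sK sy.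
have -> : z + t *: eta = x + (1 - th) *: (y - x).
  have mmE : mm * (1 - th) = t * be by rewrite /mm divfK.
  have -> : x + (1 - th) *: (y - x) = x + (1 - th) *: (z - x) + (mm * (1 - th)) *: e.
    by apply: eq_pair2; rewrite /y /= /GRing.scale /=; ring.
  by rewrite mmE beE /th; apply: eq_pair2; rewrite /= /GRing.scale /=; ring.
apply: open_convex_segment => //; [exact: open_cell|exact: convex_cell|lra].
Qed.

(** The closed cells share a segment of positive length, so they meet along an entire edge. A
    non-endpoint of that edge lies on [s], and distinct edges are disjoint. *)
Lemma shared_edge K L s : K != L -> s \in edges_of K -> s \in edges_of L -> separates s K L.
Proof.
move=> KL sK sL.
have sKL : edgeset s `<=` closure (cellset K) `&` closure (cellset L).
  move=> z sz; have cz := @subset_closure _ (edgeset s) _ sz.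
  by split; [exact: (edge_boundary sK cz).1|exact: (edge_boundary sL cz).1].
case: (cell_meet adm KL) => [/(zero_length_subset sKL)/zero_length_oseg h|[s' ss']].
  by have := edge_nondeg adm s; rewrite h eqxx.
have [_ _ _ eKL] := ss'.
have [z sz] := oseg_not_in [:: end1 s'; end2 s'] (edge_nondeg adm s).
rewrite !inE negb_or => /andP[z1 z2].
have : closure (edgeset s') z by rewrite -eKL; exact: sKL.
move=> /closure_oseg/cseg_oseg/(_ z1 z2) s'z.
suff -> : s = s' by [].
apply/eqP; apply: contraT => /(edge_disjoint adm).
by rewrite -subset0 => /(_ z (conj sz s'z)).
Qed.

Lemma separates_sym s K L : separates s K L -> separates s L K.
Proof. by case=> KL sK sL h; apply: shared_edge => //; rewrite eq_sym. Qed.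

Lemma edge_point s : exists z, edgeset s z.
Proof. by have [z sz _] := oseg_not_in [::] (edge_nondeg adm s); exists z. Qed.

(** With both cells on the same side, a ray from a point of the edge would enter the two disjoint
    cells at once. *)
Lemma edge_sides_opposite K L s : K != L -> s \in edges_of K -> s \in edges_of L ->
  edge_side s (center K) * edge_side s (center L) < 0.
Proof.
move=> KL sK sL; have Kx := center_in adm K; have Lx := center_in adm L.
have nK := edge_side_cell_neq0 sK Kx; have nL := edge_side_cell_neq0 sL Lx.
rewrite lt_neqAle mulf_neq0 //= leNgt; apply/negP => h.
have [z sz] := edge_point s.
have zs : edge_side s z = 0 by exact/edge_side_cseg/edgeset_cseg.
have exz : det (edge_vec s) (center K - z) = edge_side s (center K).
  by rewrite -[LHS]addr0 -zs /edge_side /det /=; ring.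
have hK : 0 < det (edge_vec s) (center K - z) * edge_side s (center K).
  by rewrite exz -expr2 lt_def sqrf_eq0 nK sqr_ge0.
have hL : 0 < det (edge_vec s) (center K - z) * edge_side s (center L) by rewrite exz.
have [d1 d10 hd1] := edge_ray sK sz hK.
have [d2 d20 hd2] := edge_ray sL sz hL.
pose t := Num.min d1 d2 / 2.
have m0 : 0 < Num.min d1 d2 by rewrite lt_min d10.
have m1 : Num.min d1 d2 <= d1 by rewrite ge_min lexx.
have m2 : Num.min d1 d2 <= d2 by rewrite ge_min lexx orbT.
have k1 := hd1 t ltac:(rewrite /t; lra); have k2 := hd2 t ltac:(rewrite /t; lra).
by move/eqP: KL; apply; exact: cell_unique k1 k2.
Qed.

(** Three cells would give three pairwise opposite signs. Hence the [pick] in [neighbor] has at most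
    one candidate. *)
Lemma edge_two_cells K L L' s : s \in edges_of K -> s \in edges_of L -> s \in edges_of L' ->
  K != L -> K != L' -> L = L'.
Proof.
move=> sK sL sL' KL KL'; apply/eqP; apply: contraT => LL'.
have h1 := edge_sides_opposite KL sK sL; have h2 := edge_sides_opposite KL' sK sL'.
have h3 := edge_sides_opposite LL' sL sL'.
have := sqr_ge0 (edge_side s (center K)).
have : 0 < (edge_side s (center K) * edge_side s (center L)) *
  (edge_side s (center K) * edge_side s (center L')) by rewrite nmulr_rgt0.
by nra.
Qed.

Lemma neighbor_separates K L s : (neighbor K s == Some L) = `[< separates s K L >].
Proof.
rewrite /neighbor; case: pickP => [L' /asboolP sL'|h]; last by rewrite h.
apply/eqP/asboolP => [[<-]//|sL]; congr Some.
by case: sL' sL => [? ? ? _] [? ? ? _]; exact: (@edge_two_cells K _ _ s).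
Qed.

Lemma neighbor_sym K L s : (neighbor K s == Some L) = (neighbor L s == Some K).
Proof.
by rewrite !neighbor_separates; apply/asboolP/asboolP; exact: separates_sym.
Qed.

Lemma neighbor_exterior K s : s \in edges_of K ->
  (neighbor K s = None) <-> exterior_edge s.
Proof.
move=> sK; split.
  rewrite /neighbor; case: pickP => // h _ [L [L' sep]].
  have [LL' sL sL' _] := sep.
  have [LK|LK] := eqVneq K L.
    by move: (h L'); rewrite LK; move/asboolP; exact.
  by move: (h L) => /asboolP; apply; exact: shared_edge.
move=> ex; rewrite /neighbor; case: pickP => // L /asboolP h.
by case: ex; exists K, L.
Qed.

Definition mesh_vertices : seq (R * R) :=
  [seq end1 s | s <- enum (edge M)] ++ [seq end2 s | s <- enum (edge M)].

Lemma not_mesh_vertex z s : z \notin mesh_vertices -> (z != end1 s) /\ (z != end2 s).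
Proof.
rewrite mem_cat negb_or => /andP[h1 h2]; split.
- by apply: contraNneq h1 => ->; apply/mapP; exists s => //; rewrite mem_enum.
- by apply: contraNneq h2 => ->; apply/mapP; exists s => //; rewrite mem_enum.
Qed.

Lemma closure_domain_cell x : closure Om x <-> exists K, closure (cellset K) x.
Proof.
rewrite (cell_cover adm); split=> [[K _ h]|[K h]]; by exists K.
Qed.

(** Away from the vertices, another closed cell containing [z] would share [s] with [L] and make it
    interior. So the finitely many other closed cells keep away from [z], near which the closed
    domain reduces to the closure of [L]. *)
Lemma exterior_one_sided L s z : exterior_edge s -> s \in edges_of L -> edgeset s z ->
  z \notin mesh_vertices ->
  \forall y \near z, closure Om y -> 0 <= edge_side s (center L) * edge_side s y.
Proof.
move=> ex sL sz zv.
have far C : C != L -> ~ closure (cellset C) z.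
  move=> CL cz.
  have Cz : ~ cellset C z by apply: (@edge_not_cell s); exact: subset_closure.
  have [s' s'C s'z] := cell_boundary_edge cz Cz.
  have [z1 z2] := not_mesh_vertex s' zv.
  have {}s'z := cseg_oseg s'z z1 z2.
  have ss' : s = s'.
    apply/eqP; apply: contraT => /(edge_disjoint adm).
    by rewrite -subset0 => /(_ z (conj sz s'z)).
  case: ex; exists C, L; apply: shared_edge => //; by rewrite ss'.
have : \forall y \near z, forall C, C != L -> ~ closure (cellset C) y.
  suff h (C : cell M) : \forall y \near z, C != L -> ~ closure (cellset C) y.
    exact: (@filter_forall _ (cell M) (fun C y => C != L -> ~ closure (cellset C) y) (nbhs z) _ h).
  case: (eqVneq C L) => [->|CL]; first by apply/nbhs2P; exists 1.
  have oC : open (~` closure (cellset C)) by exact/closed_openC/closed_closure.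
  have := open_nbhs_nbhs (conj oC (far C CL)); by apply: filterS => y.
apply: filterS => y hy /closure_domain_cell[C Cy].
have CL : C = L by apply/eqP; apply: contraT => /hy.
by rewrite CL in Cy; exact: edge_side_closure sL (center_in adm L) Cy.
Qed.
End MeshLocal.

(** * Walking along a segment across the mesh *)

Section Crossing.
Context {R : realType} {M : mesh R}.
Implicit Types (K L : cell M) (s : edge M) (x y z eta : R * R).

Definition crosses eta x (T : R) s : bool :=
  (0 < cross_abs (end1 s) (edge_vec s) eta x < 1) &&
  (0 < cross_time (end1 s) (edge_vec s) eta x < T).

(** A Dirichlet edge carries the ghost value 0, which is that of w^(p/2) - 1 at the steady state; a
    no-flux edge carries no jump. *)
Definition jump GD (v : cell M -> R) K s : R :=
  match neighbor K s with
  | Some L => v L - v K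
  | None => if `[< dirichlet_edge GD s >] then - v K else 0
  end.

(** For an edge crossed on the way out of [K], this is the increase of [dot eta] from [center K] to
    the next center, or to the foot of the perpendicular on an exterior edge. *)
Definition edge_progress eta K s : R :=
  edge_dist K s * `|det (edge_vec s) eta| / edge_length s.

Definition crossed_energy GD (v : cell M -> R) eta x T : R :=
  \sum_K \sum_(s in edges_of K) 
     (crosses eta x T s)%:R * (jump GD v K s ^+ 2 / edge_progress eta K s).

Lemma edge_progress_ge0 eta K s : 0 <= edge_progress eta K s.
Proof.
rewrite divr_ge0 ?sqrtr_ge0 // mulr_ge0 // /edge_dist /dist_to_edge.
by case: neighbor => [L|]; exact: sqrtr_ge0.
Qed.

Lemma crosses_shift eta x (t T : R) s : 0 <= t ->
  crosses eta (x + t *: eta) (T - t) s -> crosses eta x T s.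
Proof.
move=> t0; rewrite /crosses.
have [d0|d0] := eqVneq (det (edge_vec s) eta) 0.
  by rewrite /cross_abs d0 invr0 mulr0 ltxx.
have -> : cross_abs (end1 s) (edge_vec s) eta (x + t *: eta) = cross_abs (end1 s) (edge_vec s) eta x.
  by rewrite /cross_abs /det /= /GRing.scale /=; congr (_ / _); ring.
have -> : cross_time (end1 s) (edge_vec s) eta (x + t *: eta) =
    cross_time (end1 s) (edge_vec s) eta x - t.
  by rewrite /cross_time /det /= /GRing.scale /=; field.
move=> /andP[-> /andP[h1 h2]] /=; lra.
Qed.

Lemma crossesP eta x (T t : R) s : det (edge_vec s) eta != 0 ->
  edgeset s (x + t *: eta) ->
  crosses eta x T s = (0 < t < T).
Proof.
move=> d0 [u /= u01 zE]; rewrite /crosses.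
have zE1 := congr1 fst zE; have zE2 := congr1 snd zE; rewrite /= /GRing.scale /= in zE1 zE2.
have -> : cross_abs (end1 s) (edge_vec s) eta x = u.
  apply: (mulIf d0); rewrite /cross_abs divfK //.
  have x1 : x.1 = (end1 s).1 + u * ((end2 s).1 - (end1 s).1) - t * eta.1 by lra.
  have x2 : x.2 = (end1 s).2 + u * ((end2 s).2 - (end1 s).2) - t * eta.2 by lra.
  by rewrite /det /= x1 x2; ring.
rewrite u01 /=; suff -> : cross_time (end1 s) (edge_vec s) eta x = t by [].
apply: (mulIf d0); rewrite /cross_time divfK //.
have x1 : x.1 = (end1 s).1 + u * ((end2 s).1 - (end1 s).1) - t * eta.1 by lra.
have x2 : x.2 = (end1 s).2 + u * ((end2 s).2 - (end1 s).2) - t * eta.2 by lra.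
by rewrite /det /= x1 x2; ring.
Qed.

(** Induction step of a weighted Cauchy-Schwarz inequality: [d], [d'] are the increments over the
    next edge and over the rest of the walk, [q], [B] the weights, [d ^+ 2 / q] and [A] the
    energies. The cross term yields to the arithmetic-geometric mean inequality. *)
Lemma cauchy_schwarz_step (d d' q A B : R) : 0 < q -> 0 <= A -> 0 <= B ->
  d' ^+ 2 <= A * B -> (d + d') ^+ 2 <= (d ^+ 2 / q + A) * (q + B).
Proof.
move=> q0 A0 B0 h.
have -> : (d ^+ 2 / q + A) * (q + B) = d ^+ 2 + (d ^+ 2 / q * B + A * q) + A * B.
  by field; rewrite gt_eqF.
suff : 2 * (d * d') <= d ^+ 2 / q * B + A * q.
  by rewrite sqrrD -mulr_natr; lra.
have q1 : 0 < q^-1 by rewrite invr_gt0.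
set X := d ^+ 2 / q * B; set Y := A * q.
have X0 : 0 <= X by rewrite /X mulr_ge0 // divr_ge0 ?sqr_ge0 // ltW.
have Y0 : 0 <= Y by rewrite mulr_ge0 // ltW.
have XY : X * Y = d ^+ 2 * (A * B) by rewrite /X /Y; field; rewrite gt_eqF.
have h4 : (2 * (d * d')) ^+ 2 <= (X + Y) ^+ 2.
  have : (d * d') ^+ 2 <= X * Y.
    by rewrite XY exprMn; apply: ler_wpM2l => //; exact: sqr_ge0.
  have := sqr_ge0 (X - Y); nra.
apply: le_trans (ler_norm _) _.
by rewrite -ler_sqr ?nnegrE ?normr_ge0 ?addr_ge0 // -normrX ger0_norm ?sqr_ge0.
Qed.

End Crossing.

Section Walk.
Context {R : realType} {M : mesh R} {Om GD GN : set (R * R)}.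
Hypothesis adm : admissible M Om GD GN.
Variable eta : R * R.
Implicit Types (K L : cell M) (s : edge M) (x y z : R * R).

Lemma open_line (A : set (R * R)) z : open A -> A z ->
  exists2 d : R, 0 < d & forall u, `|u| < d -> A (z + u *: eta).
Proof.
move=> oA Az; have /nbhs2P[e e0 eA] := oA z Az.
have b0 : 0 < `|eta.1| + `|eta.2| + 1 by rewrite ltr_wpDl ?addr_ge0.
exists (e / (`|eta.1| + `|eta.2| + 1)); first exact: divr_gt0.
move=> u; rewrite ltr_pdivlMr // => hu.
have h1 : 0 <= `|u| * `|eta.1| by rewrite mulr_ge0.
have h2 : 0 <= `|u| * `|eta.2| by rewrite mulr_ge0.
have hE : `|u| * (`|eta.1| + `|eta.2| + 1) = `|u| * `|eta.1| + `|u| * `|eta.2| + `|u| by ring.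
have h3 := normr_ge0 u.
apply: eA; rewrite /= /GRing.scale /= addrC addKr normrM; lra.
Qed.

(** The exit time is the supremum of the times spent in [K]: convexity gives membership at all
    earlier times, openness excludes it at the supremum. *)
Lemma cell_exit K x (T : R) : cellset K x -> 0 < T -> ~ cellset K (x + T *: eta) ->
  exists t, [/\ 0 < t <= T, closure (cellset K) (x + t *: eta),
    ~ cellset K (x + t *: eta) & forall u, 0 <= u < t -> cellset K (x + u *: eta)].
Proof.
move=> Kx T0 nK.
have oK := open_cell adm (K := K).
pose S := [set u : R | 0 <= u <= T /\ cellset K (x + u *: eta)].
have S0 : S 0 by split; [lra|rewrite scale0r addr0].
have hS : has_sup S by split; [exists 0|exists T => u [/andP[]]].
have tT : sup S <= T by apply: ge_sup; [exists 0|move=> u [/andP[]]].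
have below u : 0 <= u < sup S -> cellset K (x + u *: eta).
  move=> /andP[u0 ut]; have su : 0 < sup S - u by rewrite subr_gt0.
  have [w [/andP[w0 wT] Kw]] := sup_adherent su hS; rewrite opprB addrC subrK => uw.
  have wn : w != 0 by rewrite gt_eqF //; exact: le_lt_trans uw.
  have h01 : 0 <= u / w <= 1.
    by rewrite divr_ge0 //= ler_pdivrMr ?mul1r ?(ltW uw) //; exact: le_lt_trans uw.
  have := convex_segment (convex_cell adm (K := K)) Kx Kw h01.
  by congr (cellset K); apply: eq_pair2; rewrite /= /GRing.scale /=; field.
have notin : ~ cellset K (x + sup S *: eta).
  move=> Kz; have [d d0 hd] := open_line oK Kz.
  have [tE|tn] := eqVneq (sup S) T; first by rewrite tE in Kz.
  have lt : sup S < T by rewrite lt_neqAle tn.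
  pose u := Num.min (d / 2) (T - sup S).
  have u0 : 0 < u by rewrite lt_min; lra.
  have u1 : u <= d / 2 by rewrite ge_min lexx.
  have u2 : u <= T - sup S by rewrite ge_min lexx orbT.
  have s0 : 0 <= sup S by apply: ub_le_sup S0; exact: hS.2.
  have : S (sup S + u).
    split; first lra.
    by rewrite scalerDl addrA; apply: hd; rewrite gtr0_norm //; lra.
  by move/(ub_le_sup hS.2); lra.
have s0 : 0 <= sup S by apply: ub_le_sup S0; exact: hS.2.
have sn : 0 < sup S.
  rewrite lt_neqAle s0 andbT; apply/eqP => h.
  by apply: notin; rewrite -h scale0r addr0.
exists (sup S); split => //; first by rewrite sn.
apply/closure2P => e e0.
have b0 : 0 < `|eta.1| + `|eta.2| + 1 by rewrite ltr_wpDl ?addr_ge0.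
pose u := Num.min (sup S / 2) (e / (`|eta.1| + `|eta.2| + 1) / 2).
have e1 : 0 < e / (`|eta.1| + `|eta.2| + 1) by rewrite divr_gt0.
have u0 : 0 < u by rewrite lt_min; lra.
have u1 : u <= sup S / 2 by rewrite ge_min lexx.
have : u < e / (`|eta.1| + `|eta.2| + 1).
  apply: (@le_lt_trans _ _ (e / (`|eta.1| + `|eta.2| + 1) / 2)); last lra.
  by rewrite ge_min lexx orbT.
rewrite ltr_pdivlMr // => u2.
have h1 : 0 <= u * `|eta.1| by rewrite mulr_ge0 // ltW.
have h2 : 0 <= u * `|eta.2| by rewrite mulr_ge0 // ltW.
have hE : u * (`|eta.1| + `|eta.2| + 1) = u * `|eta.1| + u * `|eta.2| + u by ring.
exists (x + (sup S - u) *: eta); split; first by apply: below; lra.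
- rewrite /= /GRing.scale /= (_ : _ - _ = - (u * eta.1)); last by ring.
  by rewrite normrN normrM (gtr0_norm u0); lra.
- rewrite /= /GRing.scale /= (_ : _ - _ = - (u * eta.2)); last by ring.
  by rewrite normrN normrM (gtr0_norm u0); lra.
Qed.

(** The line through [x] along [eta] avoids all vertices, hence also all edges parallel to it: edges
    are met transversally, at inner points. *)
Definition generic_point x := forall s : edge M,
  det (end1 s - x) eta != 0 /\ det (end2 s - x) eta != 0.

Lemma generic_shift x (t : R) : generic_point x -> generic_point (x + t *: eta).
Proof.
move=> gx s; have [h1 h2] := gx s.
have E (a : R * R) : det (a - (x + t *: eta)) eta = det (a - x) eta.
  by rewrite /det /= /GRing.scale /=; ring.
by rewrite !E.
Qed.

Lemma generic_exit K x (T : R) : generic_point x -> cellset K x -> 0 < T ->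
  ~ cellset K (x + T *: eta) ->
  exists t s, [/\ 0 < t <= T, s \in edges_of K, edgeset s (x + t *: eta) &
    det (edge_vec s) eta * edge_side s (center K) < 0].
Proof.
move=> gx Kx T0 nK; have [t [tT cz nz _]] := cell_exit Kx T0 nK.
have [s sK sz] := cell_boundary_edge adm cz nz.
have [g1 g2] := generic_shift t gx s.
have z1 : x + t *: eta != end1 s.
  by apply: contraNneq g1 => ->; rewrite subrr /det /= !mul0r subrr.
have z2 : x + t *: eta != end2 s.
  by apply: contraNneq g2 => ->; rewrite subrr /det /= !mul0r subrr.
have {}sz := cseg_oseg sz z1 z2.
exists t, s; split => //.
have zs : edge_side s (x + t *: eta) = 0 by exact/edge_side_cseg/edgeset_cseg.
rewrite edge_side_affine in zs.
have := edge_side_cell adm sK Kx (center_in adm K).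
have -> : edge_side s x = - (t * det (edge_vec s) eta) by lra.
rewrite mulNr oppr_gt0 -mulrA => h.
by rewrite -(pmulr_rlt0 _ (_ : 0 < t)) //; lra.
Qed.

Lemma enormB (x y : R * R) : enorm (x - y) = enorm (y - x).
Proof. by rewrite /enorm /dot /=; congr Num.sqrt; ring. Qed.

Lemma dot_edge_vec_gt0 s : 0 < dot (edge_vec s) (edge_vec s).
Proof. by rewrite -enorm2 exprn_gt0 // enorm_gt0 // (edge_vec_neq0 adm). Qed.

(** Orthogonality gives the absolute value; the sign follows since the centers lie on opposite sides
    of the edge and [eta] points out of [K]. *)
Lemma edge_progress_interior K L s : separates s K L ->
  det (edge_vec s) eta * edge_side s (center K) < 0 ->
  0 < edge_progress eta K s /\
  edge_progress eta K s = dot eta (center L - center K).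
Proof.
move=> sep hd; have [KL sK sL _] := sep.
have nb : neighbor K s = Some L by apply/eqP; rewrite (neighbor_separates adm); apply/asboolP.
have [_ orth] := center_interior adm sep.
have ws : dot eta (center L - center K) * dot (edge_vec s) (edge_vec s) =
    (edge_side s (center L) - edge_side s (center K)) * det (edge_vec s) eta.
  by rewrite dot_det //; congr (_ * _); rewrite /edge_side /det /=; ring.
have w0 : 0 < dot eta (center L - center K).
  rewrite -(pmulr_lgt0 _ (dot_edge_vec_gt0 s)) ws.
  have kl := edge_sides_opposite adm KL sK sL.
  have h : 0 < (edge_side s (center K) * edge_side s (center L)) *
    (det (edge_vec s) eta * edge_side s (center K)) by rewrite nmulr_rgt0.
  have h2 := sqr_ge0 (edge_side s (center K)).
  have h3 : 0 < edge_side s (center L) * det (edge_vec s) eta.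
    rewrite ltNge; apply/negP => h4; nra.
  lra.
suff pE : edge_progress eta K s = dot eta (center L - center K) by rewrite pE.
rewrite /edge_progress /edge_dist nb enormB (dot_orth _ (edge_vec_neq0 adm s) orth).
by rewrite gtr0_norm.
Qed.

(** The foot of the perpendicular stands in for the missing neighboring center. It lies on the
    closed edge, hence in the closed domain, which will bound the total progress. *)
Lemma edge_progress_exterior K s : exterior_edge s -> s \in edges_of K ->
  det (edge_vec s) eta * edge_side s (center K) < 0 ->
  exists y, [/\ closure Om y, 0 < edge_progress eta K s &
  edge_progress eta K s = dot eta (y - center K)].
Proof.
move=> ex sK hd.
have nb : neighbor K s = None by apply/(neighbor_exterior adm sK).
have [y [cy orth]] := center_exterior adm ex sK.
have [u _ yE] := closure_oseg cy.
have yp : y = proj_line (end1 s) (end2 s) (center K).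
  rewrite -yE /proj_line; congr (_ + _ *: _); have := dot_edge_vec_gt0 s => d0.
  have dn : dot (end2 s - end1 s) (end2 s - end1 s) != 0 by rewrite gt_eqF.
  apply: (mulIf dn); rewrite divfK //; move: orth; rewrite -yE /dot /= /GRing.scale /=; lra.
have ws : dot eta (y - center K) * dot (edge_vec s) (edge_vec s) =
    (edge_side s y - edge_side s (center K)) * det (edge_vec s) eta.
  by rewrite dot_det //; congr (_ * _); rewrite /edge_side /det /=; ring.
have w0 : 0 < dot eta (y - center K).
  rewrite -(pmulr_lgt0 _ (dot_edge_vec_gt0 s)) ws edge_side_cseg; first lra.
  exact: closure_oseg.
exists y.
suff pE : edge_progress eta K s = dot eta (y - center K).
  split; rewrite ?pE //; apply/(closure_domain_cell adm); exists K.
  exact: (edge_boundary adm sK cy).1.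
rewrite /edge_progress /edge_dist nb /dist_to_edge -yp enormB.
by rewrite (dot_orth _ (edge_vec_neq0 adm s) orth) gtr0_norm.
Qed.

Lemma crossed_energy_ge0 (v : cell M -> R) x (T : R) : 0 <= crossed_energy GD v eta x T.
Proof.
apply: sumr_ge0 => K _; apply: sumr_ge0 => s _; rewrite mulr_ge0 //.
by rewrite divr_ge0 ?sqr_ge0 // edge_progress_ge0.
Qed.

(** From time [u >= t] on, the segment no longer crosses [s], and it crosses only edges that the
    whole segment crosses; the term of [s] can be split off. *)
Lemma crossed_energy_step (v : cell M -> R) x (t u T : R) K s : s \in edges_of K ->
  det (edge_vec s) eta != 0 -> edgeset s (x + t *: eta) -> 0 < t < T -> t <= u ->
  jump GD v K s ^+ 2 / edge_progress eta K s + crossed_energy GD v eta (x + u *: eta) (T - u)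
   <= crossed_energy GD v eta x T.
Proof.
move=> sK d0 sz tT tu.
have term_ge0 K' s' : 0 <= jump GD v K' s' ^+ 2 / edge_progress eta K' s'.
  by rewrite divr_ge0 ?sqr_ge0 // edge_progress_ge0.
have u0 : 0 <= u by lra.
have sx : crosses eta x T s by rewrite (crossesP _ d0 sz).
have nsx : crosses eta (x + u *: eta) (T - u) s = false.
  rewrite (@crossesP _ _ _ _ _ (t - u)) //; first by apply/negbTE/negP; lra.
  by move: sz; congr edgeset; apply: eq_pair2; rewrite /= /GRing.scale /=; ring.
have mono s' : (crosses eta (x + u *: eta) (T - u) s')%:R <= (crosses eta x T s')%:R :> R.
  by rewrite ler_nat; case E: (crosses _ (_ + _) _ _) => //; rewrite (crosses_shift u0 E).
rewrite /crossed_energy (bigD1 K) //= [leRHS](bigD1 K) //= addrA lerD //; last first.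
  by apply: ler_sum => K' _; apply: ler_sum => s' _; apply: ler_wpM2r.
rewrite (bigD1 s) //= nsx mul0r add0r [leRHS](bigD1 s) //= sx mul1r lerD //.
by apply: ler_sum => s' _; apply: ler_wpM2r.
Qed.

(** The walk reaches the cell of the endpoint or stops on an exterior edge. In the second case only
    a Dirichlet edge provides a boundary value to compare with, hence the implication. *)
Definition walk_end (v : cell M -> R) K x (T : R) : Prop :=
  (exists L, [/\ cellset L (x + T *: eta), 0 <= dot eta (center L - center K) &
    (v L - v K) ^+ 2 <= crossed_energy GD v eta x T * dot eta (center L - center K)]) \/
  (exists L s t y, [/\ [/\ s \in edges_of L, exterior_edge s, 0 < t < T,
      edgeset s (x + t *: eta) & det (edge_vec s) eta * edge_side s (center L) < 0],
    closure Om y, 0 <= dot eta (y - center K) &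
    dirichlet_edge GD s ->
      v K ^+ 2 <= crossed_energy GD v eta x T * dot eta (y - center K)]).

Lemma walk (v : cell M -> R) x (T : R) K : 0 < T -> generic_point x -> cellset K x ->
  (forall s, ~ edgeset s (x + T *: eta)) -> walk_end v K x T.
Proof.
move=> T0 gx Kx nE.
(* Induction on the number of edges still to be crossed, which drops whenever one is passed. *)
have [n] := ubnP (#|[pred s : edge M | crosses eta x T s]|)%N.
elim: n x T K T0 gx Kx nE => // n IH x T K T0 gx Kx nE; rewrite ltnS => cn.
have [KT|KT] := pselect (cellset K (x + T *: eta)).
  left; exists K; split => //.
    by rewrite subrr /dot /= !mulr0 addr0.
  by rewrite !subrr expr0n /= /dot /= !mulr0 addr0 mulr0.
have [t [s [/andP[t0 tT] sK sz hd]]] := generic_exit gx Kx T0 KT.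
have ltT : t < T.
  by rewrite lt_neqAle tT andbT; apply/eqP => tE; apply: (nE s); rewrite -tE.
have tT' : 0 < t < T by rewrite t0.
have d0 : det (edge_vec s) eta != 0.
  by apply: contraTneq hd => ->; rewrite mul0r ltxx.
have E0 := crossed_energy_ge0 v.
case nb : (neighbor K s) => [L|]; last first.
  have ex : exterior_edge s by apply/(neighbor_exterior adm sK).
  have [y [cy p0 pE]] := edge_progress_exterior ex sK hd.
  right; exists K, s, t, y; split => //; first by rewrite -pE ltW.
  move=> dir; rewrite -pE -ler_pdivrMr //.
  have := crossed_energy_step v sK d0 sz tT' (lexx t).
  rewrite /jump nb asboolT // sqrrN; have := E0 (x + t *: eta) (T - t); lra.
have sep : separates s K L by apply/asboolP; rewrite -(neighbor_separates adm) nb.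
have [KL _ sL _] := sep.
have [p0 pE] := edge_progress_interior sep hd.
have hL : 0 < det (edge_vec s) eta * edge_side s (center L).
  have kl := edge_sides_opposite adm KL sK sL.
  have h : 0 < (edge_side s (center K) * edge_side s (center L)) *
    (det (edge_vec s) eta * edge_side s (center K)) by rewrite nmulr_rgt0.
  have h2 := sqr_ge0 (edge_side s (center K)).
  rewrite ltNge; apply/negP => h4; nra.
have [d dp hdl] := edge_ray adm sL sz hL.
(* The walk restarts slightly beyond the edge, strictly inside [L] and before the endpoint. *)
pose ep := Num.min (d / 2) ((T - t) / 2).
have ep0 : 0 < ep by rewrite lt_min; lra.
have ep1 : ep <= d / 2 by rewrite ge_min lexx.
have ep2 : ep <= (T - t) / 2 by rewrite ge_min lexx orbT.
pose u := t + ep; pose x' := x + u *: eta.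
have Lx' : cellset L x'.
  rewrite /x' /u scalerDl addrA; apply: hdl; lra.
have xT : x' + (T - u) *: eta = x + T *: eta.
  by apply: eq_pair2; rewrite /= /GRing.scale /=; ring.
have u0 : 0 <= u by rewrite /u; lra.
have Tu : 0 < T - u by rewrite /u; lra.
have step := crossed_energy_step v sK d0 sz tT' (_ : t <= u).
have cn' : (#|[pred s : edge M | crosses eta x' (T - u) s]| < n)%N.
  apply: leq_trans cn; apply: proper_card; apply/properP; split.
    by apply/fintype.subsetP => s'; rewrite !inE; exact: crosses_shift.
  exists s; rewrite inE ?(crossesP _ d0 sz) //.
  rewrite (@crossesP _ _ _ _ _ (t - u)) //; first by apply/negP; rewrite /u; lra.
  by move: sz; congr edgeset; apply: eq_pair2; rewrite /= /GRing.scale /=; ring.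
have := IH x' (T - u) L Tu (generic_shift u gx) Lx' _ cn'; rewrite xT => /(_ nE).
have jE : jump GD v K s = v L - v K by rewrite /jump nb.
have {}step : (v L - v K) ^+ 2 / edge_progress eta K s + crossed_energy GD v eta x' (T - u) <= crossed_energy GD v eta x T.
  by rewrite -jE; apply: step; rewrite /u; lra.
have dsum (y : R * R) : dot eta (y - center K) = edge_progress eta K s + dot eta (y - center L).
  by rewrite pE /dot /=; ring.
case=> [[L' [L'T w0 wE]]|[L' [s' [t' [y [[s'L' ex' t'T s'z hd'] cy w0 wE]]]]]].
- left; exists L'; split; rewrite -?xT // dsum; first by rewrite addr_ge0 // ltW.
  have -> : v L' - v K = (v L - v K) + (v L' - v L) by ring.
  apply: le_trans (cauchy_schwarz_step _ p0 (E0 _ _) w0 wE) _.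
  by apply: ler_wpM2r step; rewrite addr_ge0 // ltW.
- right; exists L', s', (u + t'), y; split => //.
  + split => //; first lra.
    by move: s'z; congr edgeset; apply: eq_pair2; rewrite /= /GRing.scale /=; ring.
  + by rewrite dsum addr_ge0 // ltW.
  move=> /wE {}wE; rewrite dsum.
  have wE' : (- v L) ^+ 2 <= crossed_energy GD v eta x' (T - u) * dot eta (y - center L).
    by rewrite sqrrN.
  have -> : v K ^+ 2 = ((v L - v K) + - v L) ^+ 2 by ring.
  apply: le_trans (cauchy_schwarz_step _ p0 (E0 _ _) w0 wE') _.
  by apply: ler_wpM2r step; rewrite addr_ge0 // ltW.
Qed.
End Walk.

(** * Integrating the jumps over starting points *)

Section SumMeasures.
Context {d : measure_display} {T : measurableType d} {R : realType}.
Variable mu : {measure set T -> \bar R}.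

Lemma integral_sum_indic (I : finType) (c : I -> R) (A : I -> set T) :
  (forall i, 0 <= c i) -> (forall i, measurable (A i)) ->
  (\int[mu]_x (\sum_i c i * \1_(A i) x)%:E = \sum_i (c i)%:E * mu (A i))%E.
Proof.
move=> c0 mA.
under eq_integral do rewrite -sumEFin.
rewrite ge0_integral_sum //.
- apply: eq_bigr => i _.
  under eq_integral do rewrite EFinM.
  rewrite ge0_integralZl //; first by rewrite integral_indic // setIT.
  + by apply/measurable_EFinP; exact: measurable_indic.
  + by rewrite lee_fin.
- by move=> i; apply/measurable_EFinP; apply: measurable_funM => //; exact: measurable_indic.
- by move=> i x _; rewrite lee_fin mulr_ge0.
Qed.

(** Only combinations of indicators occur, so pointwise estimates off a null set are integrated once
    and for all into inequalities between measures. *)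
Lemma sum_measure_le (I J : finType) (c : I -> R) (e : J -> R)
    (A : I -> set T) (B : J -> set T) (N : set T) :
  (forall i, 0 <= c i) -> (forall j, 0 <= e j) ->
  (forall i, measurable (A i)) -> (forall j, measurable (B j)) ->
  measurable N -> mu N = 0%E ->
  (forall x, ~ N x -> \sum_i c i * \1_(A i) x <= \sum_j e j * \1_(B j) x) ->
  (\sum_i (c i)%:E * mu (A i) <= \sum_j (e j)%:E * mu (B j))%E.
Proof.
move=> c0 e0 mA mB mN N0 h.
have AN i : mu (A i) = mu (A i `\` N).
  apply/eqP; rewrite eq_le; apply/andP; split.
    rewrite -[X in (_ <= X)%E]addr0 -N0 -measureU //.
    - apply: le_measure; rewrite ?inE //.
        by apply: measurableU => //; exact: measurableD.
      by move=> x Ax; have [|] := pselect (N x); [right|left].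
    - exact: measurableD.
    - by apply/seteqP; split => x // [[]].
  by apply: le_measure; rewrite ?inE //; exact: measurableD.
under eq_bigr do rewrite AN.
rewrite -integral_sum_indic //.
rewrite -integral_sum_indic //; last by move=> i; exact: measurableD.
apply: ge0_le_integral => //.
- by move=> x _; rewrite lee_fin; apply: sumr_ge0 => i _; rewrite mulr_ge0.
- apply/measurable_EFinP; apply: measurable_sum => i; apply: measurable_funM => //.
  by apply: measurable_indic; exact: measurableD.
- apply/measurable_EFinP; apply: measurable_sum => i; apply: measurable_funM => //.
- move=> x _; rewrite lee_fin; have [Nx|Nx] := pselect (N x).
    rewrite big1 ?sumr_ge0 // => [j _|i _]; first by rewrite mulr_ge0.
    by rewrite indicE memNset ?mulr0 // => -[].
  apply: le_trans (h _ Nx); apply: ler_sum => i _; apply: ler_wpM2l => //.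
  by rewrite !indicE ler_nat; case: (boolP (x \in A i `\` N)) => //; rewrite inE => -[Ax _]; rewrite mem_set.
Qed.
End SumMeasures.

(** An interior edge is counted twice, once from each side. *)
Definition dissipation {R : realType} (GD : set (R * R)) (M : mesh R) (v : cell M -> R) : R :=
  \sum_K \sum_(s in edges_of K) transm K s * jump GD v K s ^+ 2.

Section AlmostEverywhere.
Context {R : realType} {M : mesh R} {Om GD GN : set (R * R)}.
Hypothesis adm : admissible M Om GD GN.
Variable eta : R * R.
Hypothesis eta0 : eta != 0.
Implicit Types (K L : cell M) (s : edge M) (x y z : R * R) (v : cell M -> R).
Local Notation mu := (lebesgue2 R).

Lemma dissipation_ge0 v : 0 <= dissipation GD v.
Proof.
apply: sumr_ge0 => K _; apply: sumr_ge0 => s _; rewrite mulr_ge0 ?sqr_ge0 //.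
rewrite divr_ge0 ?sqrtr_ge0 // /edge_dist /dist_to_edge.
by case: neighbor => [L|]; exact: sqrtr_ge0.
Qed.

Lemma generic_not_vertex x (t : R) : generic_point (M := M) eta x ->
  x + t *: eta \notin mesh_vertices (M := M).
Proof.
move=> gx; rewrite mem_cat negb_or; apply/andP; split; apply/negP => /mapP[s _ zE];
  have [] := generic_shift t gx s; rewrite -zE subrr /det /= !mul0r subrr eqxx //.
Qed.

(** Just after crossing an exterior edge, the segment would be strictly on the side where, near the
    crossing point, the closed domain has no points. *)
Lemma walk_inside v x K : generic_point (M := M) eta x -> cellset K x ->
  (forall s, ~ edgeset s (x + eta)) ->
  (forall u : R, 0 <= u <= 1 -> closure Om (x + u *: eta)) ->
  exists L, [/\ cellset L (x + eta), 0 <= dot eta (center L - center K) &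
    (v L - v K) ^+ 2 <= crossed_energy GD v eta x 1 * dot eta (center L - center K)].
Proof.
move=> gx Kx nE inO.
have := @walk _ _ _ _ _ adm eta v x 1 K ltr01 gx Kx; rewrite scale1r => /(_ nE).
rewrite /walk_end scale1r => -[//|[L [s [t [y [[sL ex /andP[t0 t1] sz hd] _ _ _]]]]]]; exfalso.
have /nbhs2P[e e0 he] := exterior_one_sided adm ex sL sz (generic_not_vertex t gx).
have b0 : 0 < `|eta.1| + `|eta.2| + 1 by rewrite ltr_wpDl ?addr_ge0.
pose u := Num.min (1 - t) (e / (`|eta.1| + `|eta.2| + 1) / 2).
have e1 : 0 < e / (`|eta.1| + `|eta.2| + 1) by rewrite divr_gt0.
have u0 : 0 < u by rewrite lt_min; lra.
have u1 : u <= 1 - t by rewrite ge_min lexx.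
have : u < e / (`|eta.1| + `|eta.2| + 1).
  apply: (@le_lt_trans _ _ (e / (`|eta.1| + `|eta.2| + 1) / 2)); last lra.
  by rewrite ge_min lexx orbT.
rewrite ltr_pdivlMr // => u2.
have h1 : 0 <= u * `|eta.1| by rewrite mulr_ge0 // ltW.
have h2 : 0 <= u * `|eta.2| by rewrite mulr_ge0 // ltW.
have hE : u * (`|eta.1| + `|eta.2| + 1) = u * `|eta.1| + u * `|eta.2| + u by ring.
have zs : edge_side s (x + t *: eta) = 0 by exact/edge_side_cseg/edgeset_cseg.
have := he (x + t *: eta + u *: eta); rewrite edge_side_affine zs add0r.
have -> : (x + t *: eta + u *: eta).1 - (x + t *: eta).1 = u * eta.1.
  by rewrite /= /GRing.scale /=; ring.
have -> : (x + t *: eta + u *: eta).2 - (x + t *: eta).2 = u * eta.2.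
  by rewrite /= /GRing.scale /=; ring.
rewrite !normrM (gtr0_norm u0) -addrA -scalerDl => h.
have : 0 <= edge_side s (center L) * (u * det (edge_vec s) eta).
  by apply: h; [lra|lra|apply: inO; lra].
by rewrite mulrCA [edge_side _ _ * _]mulrC pmulr_rge0 // leNgt hd.
Qed.

(** A finite union of lines; off it the walk meets no vertex, and neither end of the segment lies on
    the line of an edge. *)
Definition exceptional_set : set (R * R) :=
  \big[setU/set0]_(s : edge M)
   (([set x | det (end1 s - x) eta = 0] `|` [set x | det (end2 s - x) eta = 0]) `|`
    ([set x | edge_side s x = 0] `|` [set x | edge_side s (x + eta) = 0])).

Lemma lebesgue2_line_set (f : R * R -> R) (al be ga : R) : (al != 0) || (be != 0) ->
  (forall x, f x = al * x.1 + be * x.2 + ga) ->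
  measurable ([set x | f x = 0] : set (measurableTypeR R * measurableTypeR R)) /\
  mu [set x | f x = 0] = 0%E.
Proof.
move=> ab fE.
have -> : [set x | f x = 0] = [set x : R * R | al * x.1 + be * x.2 + ga = 0].
  by apply/seteqP; split => x /=; rewrite fE.
split; last exact: lebesgue2_line.
apply: closed_measurable2.
apply: closed_comp (@closed_eq R 0) => x _; exact: continuous_affine2.
Qed.

Lemma neq0_coord (e : R * R) : e != 0 -> (e.1 != 0) || (e.2 != 0).
Proof.
move=> e0; case: (eqVneq e.1 0) => //= e1; apply: contra e0 => /eqP e2.
by apply/eqP/eq_pair2.
Qed.

Lemma exceptional_set_null :
  measurable (exceptional_set : set (measurableTypeR R * measurableTypeR R)) /\
  mu exceptional_set = 0%E.
Proof.
have eta' := neq0_coord eta0.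
pose P (A : set (measurableTypeR R * measurableTypeR R)) := measurable A /\ mu A = 0%E.
have PU A B : P A -> P B -> P (A `|` B).
  by move=> [mA A0] [mB B0]; split; [exact: measurableU|exact: (null_set_setU mA mB)].
apply: (@big_ind _ P) => [|A B|s _].
- by split; [exact: measurable0|exact: measure0].
- exact: PU.
have ev := neq0_coord (edge_vec_neq0 adm s).
have h1 := @lebesgue2_line_set (fun x => det (end1 s - x) eta) (- eta.2) (eta.1)
   ((end1 s).1 * eta.2 - (end1 s).2 * eta.1) ltac:(by rewrite oppr_eq0 orbC)
   ltac:(by move=> x; rewrite /det /=; ring).
have h2 := @lebesgue2_line_set (fun x => det (end2 s - x) eta) (- eta.2) (eta.1)
   ((end2 s).1 * eta.2 - (end2 s).2 * eta.1) ltac:(by rewrite oppr_eq0 orbC)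
   ltac:(by move=> x; rewrite /det /=; ring).
have h3 := @lebesgue2_line_set (fun x => edge_side s x) (- (edge_vec s).2) (edge_vec s).1
   (- ((edge_vec s).1 * (end1 s).2 - (edge_vec s).2 * (end1 s).1)) ltac:(by rewrite oppr_eq0 orbC)
   ltac:(by move=> x; rewrite /edge_side /det /=; ring).
have h4 := @lebesgue2_line_set (fun x => edge_side s (x + eta)) (- (edge_vec s).2) (edge_vec s).1
   ((edge_vec s).1 * (eta.2 - (end1 s).2) - (edge_vec s).2 * (eta.1 - (end1 s).1)) ltac:(by rewrite oppr_eq0 orbC)
   ltac:(by move=> x; rewrite /edge_side /det /=; ring).
exact: PU (PU _ _ h1 h2) (PU _ _ h3 h4).
Qed.

Lemma not_exceptional x : ~ exceptional_set x -> [/\ generic_point (M := M) eta x,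
  forall s, edge_side s x != 0 & forall s, edge_side s (x + eta) != 0].
Proof.
move=> nx; have h s : ~ (([set x | det (end1 s - x) eta = 0] `|` [set x | det (end2 s - x) eta = 0]) `|`
    ([set x | edge_side s x = 0] `|` [set x | edge_side s (x + eta) = 0])) x.
  by move=> sx; apply: nx; rewrite /exceptional_set (bigD1 s) //=; left.
split=> s; have := h s; rewrite /=.
- by move=> h'; split; apply/eqP => ?; apply: h'; left; [left|right].
- by move=> h'; apply/eqP => ?; apply: h'; right; left.
- by move=> h'; apply/eqP => ?; apply: h'; right; right.
Qed.

Lemma not_exceptional_cell x : closure Om x -> (forall s, edge_side s x != 0) ->
  exists K, cellset K x.
Proof.
move=> /(closure_domain_cell adm)[K cx] h; exists K; apply: contrapT => nx.
have [s _ sx] := cell_boundary_edge adm cx nx.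
by have := h s; rewrite (edge_side_cseg sx) eqxx.
Qed.

(* Integrating the crossed energy turns the crossing indicators into areas of
   parallelograms, which produces the transmissivities. *)
Lemma energy_integral (c e : cell M -> R) (A B : cell M -> set (R * R)) (b : R) v :
  (forall K, 0 <= c K) -> (forall K, 0 <= e K) -> 0 <= b ->
  (forall K, measurable (A K : set (measurableTypeR R * measurableTypeR R))) ->
  (forall K, measurable (B K : set (measurableTypeR R * measurableTypeR R))) ->
  (forall x, ~ exceptional_set x ->
    \sum_K c K * \1_(A K) x <= \sum_K e K * \1_(B K) x + b * crossed_energy GD v eta x 1) ->
  (\sum_K (c K)%:E * mu (A K) <=
   \sum_K (e K)%:E * mu (B K) + (b * dissipation GD v)%:E)%E.
Proof.
move=> c0 e0 b0 mA mB h.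
pose term (p : cell M * edge M) : R := (p.2 \in edges_of p.1)%:R *
  (b * (jump GD v p.1 p.2 ^+ 2 / edge_progress eta p.1 p.2)).
pose C (p : cell M * edge M) := cross_set (end1 p.2) (edge_vec p.2) eta.
(* Cells and cell-edge pairs are merged into one index type, so that both terms on the right form a
   single family. *)
pose ee (j : cell M + (cell M * edge M)) := match j with inl K => e K | inr p => term p end.
pose BB (j : cell M + (cell M * edge M)) := match j with inl K => B K | inr p => C p end.
have t0 p : 0 <= term p.
  rewrite /term; apply: mulr_ge0 => //; apply: mulr_ge0 => //.
  by rewrite divr_ge0 ?sqr_ge0 // edge_progress_ge0.
have mC p : measurable (C p : set (measurableTypeR R * measurableTypeR R)).
  by apply: open_measurable2; exact: open_cross_set.
have [mN N0] := exceptional_set_null.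
have := @sum_measure_le _ _ _ mu _ _ c ee A BB exceptional_set c0 _ mA _ mN N0.
move=> /(_ ltac:(by case) ltac:(by case)).
rewrite !big_sumType /=; move=> key; apply: le_trans (key _) _; last first.
  rewrite leeD2l // (@le_trans _ _ (\sum_p (term p * `|det (edge_vec p.2) eta|)%:E)%E) //.
    apply: lee_sum => p _; rewrite [leRHS]EFinM; apply: lee_wpmul2l; first by rewrite lee_fin.
    exact: lebesgue2_cross_set.
  rewrite sumEFin lee_fin -(pair_big xpredT xpredT (fun K s => term (K, s) * `|det (edge_vec s) eta|)) /=.
  rewrite mulr_sumr; apply: ler_sum => K _.
  rewrite mulr_sumr [leRHS]big_mkcond /=; apply: ler_sum => s _.
  rewrite /term /=; case: ifP => sK; last by rewrite !mul0r.
  rewrite mul1r -mulrA; apply: ler_wpM2l => //; rewrite [leRHS]mulrC -[leLHS]mulrA.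
  apply: ler_wpM2l; first exact: sqr_ge0.
  rewrite /edge_progress /transm.
  have [d0|d0] := eqVneq (det (edge_vec s) eta) 0.
    rewrite d0 normr0 mulr0 divr_ge0 ?sqrtr_ge0 // /edge_dist /dist_to_edge.
    by case: neighbor => [L|]; exact: sqrtr_ge0.
  have dn : `|det (edge_vec s) eta| != 0 by rewrite normr_eq0.
  by rewrite invf_div invfM -!mulrA mulVf // mulr1.
move=> x /h; move/le_trans; apply; rewrite big_sumType /= lerD2l.
rewrite -(pair_big xpredT xpredT (fun K s => term (K, s) * \1_(C (K, s)) x)) /=.
rewrite mulr_sumr; apply: ler_sum => K _.
rewrite mulr_sumr [leLHS]big_mkcond /=; apply: ler_sum => s _.
rewrite /term /=; case: ifP => sK; last by rewrite !mul0r.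
rewrite mul1r indicE -mulrA ler_wpM2l // mulrC.
suff -> : (x \in C (K, s)) = crosses eta x 1 s by [].
apply/idP/idP; rewrite inE /crosses; last by move=> /andP[].
by move=> [-> ->].
Qed.
End AlmostEverywhere.

(** * Sets on which the Poincare inequality holds *)

Section Good.
Context {R : realType} {Om GD : set (R * R)}.
Local Notation mu := (lebesgue2 R).
Local Notation plane := (measurableTypeR R * measurableTypeR R)%type.
Implicit Types (A B : set (R * R)).

(** The sum is the integral over [A] of the square of the piecewise constant function with values
    [v]. The constant precedes the mesh and the no-flux part in the quantifiers, which makes it
    uniform. *)
Definition good A : Prop := measurable (A : set plane) /\ exists2 C : R, 0 <= C &
  forall (M : mesh R) (GN : set (R * R)), admissible M Om GD GN ->
  boundary Om = GD `|` GN -> zero_length (GD `&` GN) -> forall v : cell M -> R,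
  (\sum_K (v K ^+ 2)%:E * mu (A `&` cellset K) <= (C * dissipation GD v)%:E)%E.

Lemma measurable_cell (M : mesh R) GN (K : cell M) : admissible M Om GD GN ->
  measurable (cellset K : set plane).
Proof. by move=> adm; apply: open_measurable2; exact: (open_cell adm). Qed.

Lemma good_subset A B : measurable (A : set plane) -> A `<=` B -> good B -> good A.
Proof.
move=> mA AB [mB [C C0 hC]]; split; first exact: mA.
exists C; first exact: C0.
move=> M GN adm bO zl v.
apply: le_trans (hC M GN adm bO zl v); apply: lee_sum => K _.
apply: lee_wpmul2l; first by rewrite lee_fin sqr_ge0.
have mK := measurable_cell K adm.
by apply: le_measure; rewrite ?inE; [exact: measurableI|exact: measurableI|move=> x [/AB]].
Qed.

Lemma good_setU A B : good A -> good B -> good (A `|` B).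
Proof.
move=> [mA [C C0 hC]] [mB [D D0 hD]]; split; first exact: measurableU.
exists (C + D); first exact: addr_ge0.
move=> M GN adm bO zl v; rewrite mulrDl EFinD.
apply: le_trans (leeD (hC M GN adm bO zl v) (hD M GN adm bO zl v)).
rewrite -big_split; apply: lee_sum => K _ /=.
rewrite -ge0_muleDr ?measure_ge0 //; apply: lee_wpmul2l; first by rewrite lee_fin sqr_ge0.
have mK := measurable_cell K adm.
by rewrite setIUl measureU2 //; exact: measurableI.
Qed.

Lemma good_bigU (I : Type) (r : seq I) (P : pred I) (A : I -> set (R * R)) :
  (forall i, P i -> good (A i)) -> good (\big[setU/set0]_(i <- r | P i) A i).
Proof.
move=> gA; elim: r => [|i r IH].
  rewrite big_nil; split; first exact: measurable0.
  exists 0 => // M GN adm _ _ v; rewrite mul0r big1 // => K _.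
  by rewrite set0I measure0 mule0.
rewrite big_cons; case: (boolP (P i)) => [/gA gi|_]; last exact: IH.
exact: good_setU gi IH.
Qed.

Lemma bounded_closure2 : bounded_set Om -> exists2 b : R, 0 <= b &
  forall x, closure Om x -> `|x.1| <= b /\ `|x.2| <= b.
Proof.
move=> [b0 [_ hb]]; pose b := Num.max 0 (b0 + 1).
have hOm x : Om x -> `|x.1| <= b /\ `|x.2| <= b.
  move=> Ox; have := hb b ltac:(by rewrite lt_max; apply/orP; right; lra) x Ox.
  by rewrite /= prod_normE ge_max => /andP[].
exists b; first by rewrite le_max lexx.
move=> x /closure2P cx; split; apply/ler_addgt0Pr => e e0; have [y [Oy y1 y2]] := cx e e0;
  have [h1 h2] := hOm y Oy.
  by have := ler_distD y.1 x.1 0; rewrite !subr0 (distrC x.1); lra.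
by have := ler_distD y.2 x.2 0; rewrite !subr0 (distrC x.2); lra.
Qed.

Lemma dot_diff_le (b : R) (eta x y : R * R) : 0 <= b ->
  `|x.1| <= b /\ `|x.2| <= b -> `|y.1| <= b /\ `|y.2| <= b ->
  dot eta (y - x) <= 2 * b * (`|eta.1| + `|eta.2|).
Proof.
move=> b0 [x1 x2] [y1 y2]; rewrite /dot /= [leRHS]mulrDr.
have h (e u w : R) : `|u| <= b -> `|w| <= b -> e * (w - u) <= 2 * b * `|e|.
  move=> ub wb; apply: le_trans (ler_norm _) _; rewrite normrM mulrC.
  by apply: ler_wpM2r => //; have := ler_normB w u; lra.
by apply: lerD; exact: h.
Qed.

(** If [x] is in [K] and [x + eta] in [L], then v_L^2 <= 2 v_K^2 + 2 (v_L - v_K)^2. Integrated over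
    [A], the first term is controlled because [A] is good, the second by the crossed energy times
    the total progress, at most [bd]. *)
Lemma good_translate A (eta : R * R) : bounded_set Om -> good A ->
  (forall x (u : R), A x -> 0 <= u <= 1 -> closure Om (x + u *: eta)) ->
  good [set x | A (x - eta)].
Proof.
move=> bO gA hA; have [mA [C C0 hC]] := gA.
have [->|eta0] := eqVneq eta 0.
  by rewrite (_ : [set x | _] = A) //; apply/seteqP; split => x /=; rewrite subr0.
have mB : measurable ([set x | A (x - eta)] : set plane).
  have mf : measurable_fun [set: plane] (fun x : plane => (x.1 - eta.1, x.2 - eta.2) : plane).
    by apply: measurable_fun_pair; apply: measurable_funB.
  rewrite -[X in measurable X]setTI; exact: mf.
have [b b0 hb] := bounded_closure2 bO.
pose bd := 2 * b * (`|eta.1| + `|eta.2|).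
have bd0 : 0 <= bd by rewrite !mulr_ge0 // addr_ge0.
split => //; exists (2 * C + 2 * bd); first by rewrite addr_ge0 // mulr_ge0.
move=> M GN adm bGN zl v.
have mK K : measurable (cellset K : set plane) := measurable_cell K adm.
pose S (K : cell M) := [set x | A x /\ cellset K (x + eta)].
have SE K : mu ([set x | A (x - eta)] `&` cellset K) = mu (S K).
  rewrite -(lebesgue2_translate eta (measurableI _ _ mB (mK K))).
  by congr (mu _); apply/seteqP; split => x; rewrite /S /= addrK.
have mS K : measurable (S K : set plane).
  have := @measurableI _ _ _ _ mA (_ : measurable ((fun x => x + eta) @^-1` cellset K : set plane)).
  apply; have mf : measurable_fun [set: plane] (fun x : plane => (x.1 + eta.1, x.2 + eta.2) : plane).
    by apply: measurable_fun_pair; apply: measurable_funD.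
  rewrite -[X in measurable X]setTI; exact: mf.
under eq_bigr do rewrite SE.
have key : (\sum_K (v K ^+ 2)%:E * mu (S K) <=
    \sum_K (2 * v K ^+ 2)%:E * mu (A `&` cellset K) + (2 * bd * dissipation GD v)%:E)%E.
  apply: (energy_integral adm eta0) => //.
  - by move=> K; rewrite sqr_ge0.
  - by move=> K; rewrite mulr_ge0 // sqr_ge0.
  - by rewrite mulr_ge0.
  - by move=> K; exact: measurableI.
  move=> x /not_exceptional[gx sx sxe].
  have E0 := crossed_energy_ge0 (GD := GD) eta v x 1.
  have rhs0 : 0 <= \sum_K 2 * v K ^+ 2 * \1_(A `&` cellset K) x + 2 * bd * crossed_energy GD v eta x 1.
    rewrite addr_ge0 ?mulr_ge0 //; by apply: sumr_ge0 => K _; apply: mulr_ge0 => //; rewrite mulr_ge0 ?sqr_ge0.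
  have [Ax|Ax] := pselect (A x); last first.
    apply: le_trans rhs0; rewrite big1 // => K _.
    by rewrite indicE memNset ?mulr0 // => -[].
  have cx : closure Om x.
    by have := hA x 0 Ax; rewrite scale0r addr0; apply; rewrite lexx ler01.
  have [K Kx] := not_exceptional_cell adm cx sx.
  have nE (s : edge M) : ~ edgeset s (x + eta).
    by move=> ss; have := sxe s; rewrite edge_side_cseg ?eqxx //; exact: edgeset_cseg.
  have [L [Lx w0 wE]] := walk_inside adm v gx Kx nE (fun u => hA x u Ax).
  rewrite (bigD1 L) //= big1 ?addr0; last first.
    move=> L' LL'; rewrite indicE memNset ?mulr0 // => -[_ L'x].
    by move/eqP: LL'; apply; exact: (cell_unique adm L'x Lx).
  rewrite indicE mem_set ?mulr1 //.
  have : 2 * v K ^+ 2 <= \sum_K0 2 * v K0 ^+ 2 * \1_(A `&` cellset K0) x.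
    rewrite (bigD1 K) //= indicE mem_set // mulr1 lerDl; apply: sumr_ge0 => K' _.
    by apply: mulr_ge0 => //; rewrite mulr_ge0 ?sqr_ge0.
  have : (v L - v K) ^+ 2 <= bd * crossed_energy GD v eta x 1.
    apply: le_trans wE _; rewrite mulrC; apply: ler_wpM2r => //.
    by apply: dot_diff_le => //; apply: hb; apply/(closure_domain_cell adm);
      [exists K|exists L]; apply: subset_closure; exact: (center_in adm).
  have := sqr_ge0 (v L - 2 * v K); nra.
apply: le_trans key _; rewrite [in leRHS]mulrDl EFinD leeD2r //.
apply: (@le_trans _ _ (2%:E * \sum_K (v K ^+ 2)%:E * mu (A `&` cellset K))%E).
  rewrite ge0_sume_distrr; last by move=> K _; rewrite mule_ge0 // lee_fin sqr_ge0.
  by apply: lee_sum => K _; rewrite EFinM muleA.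
by rewrite -mulrA EFinM; apply: lee_wpmul2l => //; exact: hC bGN zl v.
Qed.
End Good.

(** * Spreading the estimate through the connected domain *)

Section Spread.
Context {R : realType} {Om GD : set (R * R)}.
Hypothesis bO : bounded_set Om.
Local Notation good := (@good R Om GD).
Implicit Types (A U : set (R * R)).

Definition locally_good (x : R * R) : Prop := exists2 U, good U & nbhs x U.

Lemma open_box (x : R * R) (d : R) :
  open [set y : R * R | `|y.1 - x.1| < d /\ `|y.2 - x.2| < d].
Proof.
move=> y [/= h1 h2]; apply/nbhs2P.
exists (Num.min (d - `|y.1 - x.1|) (d - `|y.2 - x.2|)); first by rewrite lt_min; lra.
move=> z; rewrite !lt_min => /andP[a1 a2] /andP[b1 b2].
have := ler_distD y.1 z.1 x.1; have := ler_distD y.2 z.2 x.2; split => /=; lra.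
Qed.

(** The locally good points form an open set. It is closed in the domain: a small good box around a
    point [g] near the limit [x] can be translated by [x - g] within a box around [x] contained in
    the domain. *)
Lemma good_connected x0 : open Om -> connected Om -> Om x0 -> locally_good x0 ->
  forall x, Om x -> locally_good x.
Proof.
move=> oO cO Ox0 g0; suff E : Om `&` [set x | locally_good x] = Om.
  by move=> x; rewrite -[X in X x]E => -[].
have oG : open [set x | locally_good x].
  move=> x [U gU /nbhs_interior xU]; apply: filterS xU => y Uy; by exists U.
apply: cO; first by exists x0.
  by exists [set x | locally_good x].
exists (closure [set x | locally_good x]); first exact: closed_closure.
apply/seteqP; split => x [Ox gx]; split => //; first exact: subset_closure.
have /nbhs2P[e e0 eO] := oO x Ox.
have e4 : 0 < e / 4 by lra.
move/closure2P : gx => /(_ _ e4)[g [[U gU /nbhs2P[d d0 dU]] g1 g2]].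
pose dd := Num.min d (e / 4).
have dd0 : 0 < dd by rewrite lt_min d0.
have dd1 : dd <= d by rewrite ge_min lexx.
have dd2 : dd <= e / 4 by rewrite ge_min lexx orbT.
pose A := [set y : R * R | `|y.1 - g.1| < dd /\ `|y.2 - g.2| < dd].
have gA : good A.
  apply: good_subset gU; first by apply: open_measurable2; exact: open_box.
  by move=> y [h1 h2]; apply: dU; lra.
have bnd (y g' x' u : R) : `|y - g'| < dd -> `|g' - x'| < e / 4 -> 0 <= u <= 1 ->
    `|y + u * (x' - g') - x'| < e.
  move=> h1 h2 u01; rewrite (_ : _ - _ = (y - g') + (1 - u) * (g' - x')); last by ring.
  apply: le_lt_trans (ler_normD _ _) _; rewrite normrM ger0_norm; last lra.
  have : (1 - u) * `|g' - x'| <= 1 * `|g' - x'| by apply: ler_wpM2r => //; lra.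
  lra.
exists [set y | A (y - (x - g))].
  apply: good_translate => // y u [h1 h2] u01; apply: subset_closure; apply: eO;
    by rewrite /= /GRing.scale /=; apply: bnd.
apply/nbhs2P; exists dd => // y h1 h2; split => /=.
  by rewrite (_ : _ - _ - _ = y.1 - x.1) //; ring.
by rewrite (_ : _ - _ - _ = y.2 - x.2) //; ring.
Qed.
End Spread.

(** * From the interior to entire closed cells *)

Section Halving.
Context {R : realType}.
Lemma cseg_half (a b z : R * R) : cseg a b z ->
  exists p y, [/\ p = a \/ p = b, cseg a b y & z = p + 2^-1 *: (y - p)].
Proof.
move=> [t /= t01 <-]; have [t2|t2] := leP t (1 / 2).
  exists a, (a + (2 * t) *: (b - a)); split; [by left|exists (2 * t) => //=; lra|].
  by apply: eq_pair2; rewrite /= /GRing.scale /=; field.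
exists b, (a + (2 * t - 1) *: (b - a)); split; [by right|exists (2 * t - 1) => //=; lra|].
by apply: eq_pair2; rewrite /= /GRing.scale /=; field.
Qed.

Lemma closure_oseg_end (a b : R * R) : closure (oseg a b) a /\ closure (oseg a b) b.
Proof.
have B0 : 0 < `|(b - a).1| + `|(b - a).2| + 1 by rewrite ltr_wpDl ?addr_ge0.
set B := `|(b - a).1| + `|(b - a).2| + 1 in B0.
have tP (e : R) : 0 < e -> exists t, [/\ 0 < t < 1, t * `|(b - a).1| < e & t * `|(b - a).2| < e].
  move=> e0; exists (Num.min (1 / 2) (e / B)).
  have t0 : 0 < Num.min (1 / 2) (e / B) by rewrite lt_min !divr_gt0.
  have t1 : Num.min (1 / 2) (e / B) <= 1 / 2 by rewrite ge_min lexx.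
  have t2 : Num.min (1 / 2) (e / B) <= e / B by rewrite ge_min lexx orbT.
  move: t0 t1 t2; set t := Num.min _ _ => t0 t1; rewrite ler_pdivlMr // /B => t2.
  have h1 : 0 <= t * `|(b - a).1| by rewrite mulr_ge0 // ltW.
  have h2 : 0 <= t * `|(b - a).2| by rewrite mulr_ge0 // ltW.
  have hE : t * (`|(b - a).1| + `|(b - a).2| + 1) = t * `|(b - a).1| + t * `|(b - a).2| + t by ring.
  by split; lra.
split; apply/closure2P => e /tP[t [t01 t1 t2]].
  exists (a + t *: (b - a)); split; first by exists t.
    by rewrite /= /GRing.scale /= addrC addKr normrM ger0_norm //; move: t01 t1 => /=; lra.
  by rewrite /= /GRing.scale /= addrC addKr normrM ger0_norm //; move: t01 t2 => /=; lra.
exists (a + (1 - t) *: (b - a)); split; first by exists (1 - t) => //=; lra.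
  rewrite /= /GRing.scale /= (_ : _ - _ = - (t * (b.1 - a.1))); last by ring.
  by rewrite normrN normrM ger0_norm //; move: t01 t1 => /=; lra.
rewrite /= /GRing.scale /= (_ : _ - _ = - (t * (b.2 - a.2))); last by ring.
by rewrite normrN normrM ger0_norm //; move: t01 t2 => /=; lra.
Qed.
End Halving.

Section GoodCell.
Context {R : realType} {M : mesh R} {Om GD GN : set (R * R)}.
Hypothesis adm : admissible M Om GD GN.
Hypothesis bO : bounded_set Om.
Local Notation good := (@good R Om GD).
Variable C : cell M.
Local Notation clC := (closure (cellset C)).

Lemma closure_cell_domain x : clC x -> closure Om x.
Proof. by move=> cx; apply/(closure_domain_cell adm); exists C. Qed.

Lemma cell_exit_boundary x (eta : R * R) : eta != 0 -> cellset C x ->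
  exists t s, [/\ 0 < t, s \in edges_of C & cseg (end1 s) (end2 s) (x + t *: eta)].
Proof.
move=> eta0 Cx; have [b b0 hb] := bounded_closure2 bO.
have big : 0 < `|eta.1| + `|eta.2|.
  have := normr_ge0 eta.1; have := normr_ge0 eta.2.
  by case/orP: (neq0_coord eta0); rewrite -normr_gt0; lra.
(* The coordinate displacements would then add up to [4 * b + 1], while points of the closed domain
   differ by at most [2 * b] in each coordinate. *)
pose T := (4 * b + 1) / (`|eta.1| + `|eta.2|).
have T0 : 0 < T by rewrite divr_gt0 //; lra.
have nT : ~ cellset C (x + T *: eta).
  move=> CT; have [x1 x2] := hb x (closure_cell_domain (@subset_closure _ _ _ Cx)).
  have [y1 y2] := hb _ (closure_cell_domain (@subset_closure _ _ _ CT)).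
  have h1 : `|T * eta.1| <= 2 * b.
    by have := ler_normB (x + T *: eta).1 x.1; rewrite /= /GRing.scale /= addrC addKr; lra.
  have h2 : `|T * eta.2| <= 2 * b.
    by have := ler_normB (x + T *: eta).2 x.2; rewrite /= /GRing.scale /= addrC addKr; lra.
  have : T * (`|eta.1| + `|eta.2|) = 4 * b + 1 by rewrite divfK // gt_eqF.
  by move: h1 h2; rewrite !(normrM T) (gtr0_norm T0) mulrDr; lra.
have [t [/andP[t0 _] ct nt _]] := cell_exit adm Cx T0 nT.
by have [s sC st] := cell_boundary_edge adm ct nt; exists t, s.
Qed.

Lemma cseg_closure_cell s y : s \in edges_of C -> cseg (end1 s) (end2 s) y -> clC y.
Proof.
move=> sC [t t01 <-]; have [e1 e2] := closure_oseg_end (end1 s) (end2 s).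
apply: convex_closure t01; first exact: (convex_cell adm).
- exact: (edge_boundary adm sC e1).1.
- exact: (edge_boundary adm sC e2).1.
Qed.

(* A point of the closed polygon gives weight at least 1/4 to one of the
   endpoints of its edges: cut by a horizontal line, then use the two edges met. *)
Lemma cell_corner x : clC x -> exists s p y, [/\ s \in edges_of C,
  p = end1 s \/ p = end2 s, clC p, clC y & x = p + (3 / 4) *: (y - p)].
Proof.
move=> cx.
have half s z : s \in edges_of C -> cseg (end1 s) (end2 s) z ->
    exists p y, [/\ p = end1 s \/ p = end2 s, clC p, clC y & z = p + 2^-1 *: (y - p)].
  move=> sC /cseg_half[p [y [pE cy zE]]]; exists p, y; split => //.
    have [e1 e2] := closure_oseg_end (end1 s) (end2 s).
    by case: pE => ->; [exact: (edge_boundary adm sC e1).1|exact: (edge_boundary adm sC e2).1].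
  exact: cseg_closure_cell sC cy.
have cvx := @convex_closure R _ _ _ _ (convex_cell adm (K := C)).
have [Cx|Cx] := pselect (cellset C x); last first.
  have [s sC /half-/(_ sC)[p [y [pE cp cy ->]]]] := cell_boundary_edge adm cx Cx.
  exists s, p, (p + (2 / 3) *: (y - p)); split => //; first by apply: (cvx) => //; lra.
  by apply: eq_pair2; rewrite /= /GRing.scale /=; field.
have n1 : ((1, 0) : R * R) != 0 by apply/eqP => -[]; lra.
have n2 : ((-1, 0) : R * R) != 0 by apply/eqP => -[]; lra.
have [t [s [t0 sC st]]] := cell_exit_boundary n1 Cx.
have [u [s' [u0 s'C s'u]]] := cell_exit_boundary n2 Cx.
have tu0 : t + u != 0 by rewrite gt_eqF // addr_gt0.
have xseg : cseg (x + t *: (1, 0)) (x + u *: (-1, 0)) x.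
  exists (t / (t + u)).
    by rewrite /= divr_ge0 ?ler_pdivrMr ?addr_gt0 //=; lra.
  by apply: eq_pair2; rewrite /= /GRing.scale /=; field.
have [z [y [zE cy xE]]] := cseg_half xseg.
have cy' : clC y.
  have [w w01 <-] := cy; apply: cvx w01; first exact: cseg_closure_cell sC st.
  exact: cseg_closure_cell s'C s'u.
have [s0 [s0C s0z]] : exists s0, s0 \in edges_of C /\ cseg (end1 s0) (end2 s0) z.
  by case: zE => ->; [exists s|exists s'].
have [p [y2 [pE cp cy2 zE']]] := half _ _ s0C s0z.
(* After two halvings [x] has weights 1/4 at [p], 1/4 at [y2] and 1/2 at [y]; the last two are
   grouped into one point of weight 3/4. *)
exists s0, p, (y + (1 / 3) *: (y2 - y)); split => //; first by apply: (cvx) => //; lra.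
by rewrite [LHS]xE zE'; apply: eq_pair2; rewrite /= /GRing.scale /=; field.
Qed.

(** For nonzero [l], the homothetic set [q + l clC], encoded as a preimage so that it is visibly
    closed. *)
Definition copy (l : R) (q : R * R) : set (R * R) := [set x | clC (l^-1 *: (x - q))].

Lemma copyP (l : R) q x : l != 0 -> copy l q x <-> exists2 y, clC y & x = q + l *: y.
Proof.
move=> l0; split=> [cx|[y cy ->]].
  by exists (l^-1 *: (x - q)) => //; apply: eq_pair2; rewrite /= /GRing.scale /=; field.
by rewrite /copy /= addrC addKr scalerA mulVf // scale1r.
Qed.

Lemma measurable_copy (l : R) q :
  measurable (copy l q : set (measurableTypeR R * measurableTypeR R)).
Proof.
apply: closed_measurable2; apply: closed_comp (@closed_closure _ (cellset C)) => x _.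
by apply: cvgZr; apply: cvgB => //; exact: cvg_cst.
Qed.

Definition good_copies (l : R) : Prop :=
  forall q, (forall y, clC y -> clC (q + l *: y)) -> good (copy l q).

(** By [cell_corner], finitely many copies of ratio [3 / 4 * l], one for each endpoint of an edge of
    [C], cover the copy of ratio [l]; convexity keeps them in the closed cell. *)
Lemma good_copies_up (l : R) : 0 < l -> good_copies (3 / 4 * l) -> good_copies l.
Proof.
move=> l0 gl q hq.
have ln : l != 0 by rewrite gt_eqF.
have ln' : 3 / 4 * l != 0 by rewrite gt_eqF // mulr_gt0 //; lra.
pose pt (i : edge M * bool) := if i.2 then end1 i.1 else end2 i.1.
have ptC i : i.1 \in edges_of C -> clC (pt i).
  move=> sC; apply: (cseg_closure_cell sC); rewrite /pt; case: i.2.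
    by exists 0; rewrite /= ?lexx ?ler01 // scale0r addr0.
  by exists 1; rewrite /= ?lexx ?ler01 // scale1r addrC subrK.
apply: good_subset (_ : _ `<=` \big[setU/set0]_(i : edge M * bool | i.1 \in edges_of C)
   copy (3 / 4 * l) (q + (l / 4) *: pt i)) _; first exact: measurable_copy.
  move=> x /(copyP _ _ ln)[y cy ->].
  have [s [p [y' [sC pE cp cy' ->]]]] := cell_corner cy.
  have [i [iC ip]] : exists i, i.1 \in edges_of C /\ pt i = p.
    by case: pE => ->; [exists (s, true)|exists (s, false)].
  rewrite (bigD1 i) //=; left; apply/copyP => //; exists y' => //.
  by rewrite ip; apply: eq_pair2; rewrite /= /GRing.scale /=; field.
apply: good_bigU => i iC; apply: gl => y cy.
rewrite (_ : _ + _ = q + l *: (pt i + (3 / 4) *: (y - pt i))).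
  apply: hq; apply: convex_closure => //; [exact: (convex_cell adm)|exact: ptC|lra].
by apply: eq_pair2; rewrite /= /GRing.scale /=; field.
Qed.

(** A small copy shrunk towards [center C] lies in its good neighborhood. Every other copy of that
    ratio in the closed cell is a translate of it, along a path that stays in the cell by
    convexity. *)
Lemma good_copies_small : locally_good (Om := Om) (GD := GD) (center C) ->
  exists2 l0 : R, 0 < l0 & forall l, 0 < l <= l0 -> l <= 1 -> good_copies l.
Proof.
move=> [U gU /nbhs2P[e e0 eU]]; have [b b0 hb] := bounded_closure2 bO.
set c := center C in eU *.
have cc : clC c by apply: subset_closure; exact: (center_in adm).
exists (e / (2 * b + 1)); first by rewrite divr_gt0 //; lra.
move=> l /andP[l0]; rewrite ler_pdivlMr; last lra.
move=> le l1 q hq; have ln : l != 0 by rewrite gt_eqF.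
pose q0 := c - l *: c.
have cvx := @convex_closure R _ _ _ _ (convex_cell adm (K := C)).
have g0 : good (copy l q0).
  apply: good_subset gU; first exact: measurable_copy.
  move=> x /(copyP _ _ ln)[y cy ->].
  have [c1 c2] := hb _ (closure_cell_domain cc).
  have [y1 y2] := hb _ (closure_cell_domain cy).
  have lE : l * (2 * b + 1) = l * (2 * b) + l by ring.
  have bnd (u w : R) : `|u| <= b -> `|w| <= b -> `|l * (u - w)| < e.
    move=> ub wb; rewrite normrM gtr0_norm //.
    have : l * `|u - w| <= l * (2 * b).
      by rewrite ler_pM2l //; have := ler_normB u w; lra.
    lra.
  apply: eU; rewrite /q0 /= /GRing.scale /=.
    by rewrite (_ : _ - _ = l * (y.1 - c.1)); [exact: bnd|ring].
  by rewrite (_ : _ - _ = l * (y.2 - c.2)); [exact: bnd|ring].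
rewrite (_ : copy l q = [set x | copy l q0 (x - (q - q0))]); last first.
  apply/seteqP; split => x; rewrite /copy /=;
  by rewrite (_ : x - (q - q0) - q0 = x - q) //; apply: eq_pair2; rewrite /=; ring.
apply: good_translate => // x u /(copyP _ _ ln)[y cy ->] u01; apply: closure_cell_domain.
rewrite (_ : _ + _ = (c + l *: (y - c)) + u *: (q + l *: y - (c + l *: (y - c)))).
  apply: (cvx) => //; last exact: hq.
  by apply: (cvx) => //; lra.
by apply: eq_pair2; rewrite /q0 /= /GRing.scale /=; ring.
Qed.

Lemma good_cell : locally_good (Om := Om) (GD := GD) (center C) -> good clC.
Proof.
move=> lg; have [l0 l00 hl] := good_copies_small lg.
have pw n : 0 < (3 / 4 : R) ^+ n <= 1.
  by apply/andP; split; [apply: exprn_gt0|apply: exprn_ile1]; lra.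
have [n nl] : exists n, (3 / 4 : R) ^+ n <= l0.
  (* Bernoulli's inequality for (4/3)^n, written without division. *)
  have h n : (3 / 4 : R) ^+ n * (1 + n%:R / 3) <= 1.
    elim: n => [|n IH]; first by rewrite expr0 mul0r addr0 mulr1.
    have n0 : 0 <= n%:R :> R by [].
    have /andP[p0 p1] := pw n.
    have pn : 0 <= (3 / 4 : R) ^+ n * n%:R by rewrite mulr_ge0 // ltW.
    have nE : n.+1%:R = n%:R + 1 :> R by rewrite natr1.
    rewrite exprSr nE; move: IH pn; set P := _ ^+ n; lra.
  exists (Num.bound (3 / l0)); set n := Num.bound _.
  have nb : 3 / l0 < n%:R by apply: archi_boundP; rewrite divr_ge0 // ltW.
  rewrite ltr_pdivrMr // in nb.
  have /andP[p0 p1] := pw n; have := h n; nra.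
have step m : good_copies ((3 / 4) ^+ m) -> good_copies 1.
  elim: m => [|m IH]; first by rewrite expr0.
  by rewrite exprS => /good_copies_up g; apply: IH; apply: g; have /andP[] := pw m.
have /step g1 : good_copies ((3 / 4) ^+ n).
  by apply: hl; have /andP[p0 p1] := pw n; rewrite ?p0.
have := g1 0; rewrite (_ : copy 1 0 = clC); first by apply => y; rewrite add0r scale1r.
by apply/seteqP; split => x; rewrite /copy /= invr1 scale1r subr0.
Qed.
End GoodCell.

(** * A good set facing a Dirichlet edge *)

Lemma cross_point {R : realType} (a e eta x : R * R) : det e eta != 0 ->
  a + cross_abs a e eta x *: e = x + cross_time a e eta x *: eta.
Proof.
case: a e eta x => [a1 a2] [e1 e2] [n1 n2] [x1 x2] d0.
by apply: eq_pair2; rewrite /cross_abs /cross_time /= /GRing.scale /= /det /=; field.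
Qed.

Lemma small_scale {R : realType} (m B : R) : 0 < m -> 0 <= B -> exists eps, [/\ 0 < eps, eps < m & eps * B < m].
Proof.
move=> m0 B0; exists (m / (2 * (B + 1))).
have e0 : 0 < m / (2 * (B + 1)) by rewrite divr_gt0 //; lra.
have eE : m / (2 * (B + 1)) * (2 * (B + 1)) = m by rewrite divfK // gt_eqF //; lra.
move: e0 eE; set eps := _ / _ => e0 eE.
have : 0 <= eps * B by rewrite mulr_ge0 // ltW.
by split; lra.
Qed.

(** A linear form that is nonnegative on both sides of an inner point, along the segment, vanishes
    in its direction. *)
Lemma oseg_parallel {R : realType} (a b z e : R * R) (d k : R) : oseg a b z -> 0 < d -> k != 0 ->
  (forall y, oseg a b y -> `|y.1 - z.1| < d -> `|y.2 - z.2| < d -> 0 <= k * det e (y - z)) ->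
  det e (b - a) = 0.
Proof.
move=> [w /= w01 zE] d0 k0 hz.
set es := b - a in zE *.
pose m := Num.min d (Num.min w (1 - w)).
have m0 : 0 < m by rewrite !lt_min; lra.
have m1 : m <= d by rewrite ge_min lexx.
have m2 : m <= w by rewrite !ge_min lexx !orbT.
have m3 : m <= 1 - w by rewrite !ge_min lexx !orbT.
have [ep [ep0 ep1 ep2]] := small_scale m0 (addr_ge0 (normr_ge0 es.1) (normr_ge0 es.2)).
have h1 : 0 <= ep * `|es.1| by rewrite mulr_ge0 // ltW.
have h2 : 0 <= ep * `|es.2| by rewrite mulr_ge0 // ltW.
rewrite mulrDr in ep2.
have side (r : R) : `|r| = ep -> 0 <= k * (r * det e es).
  move=> re; have rr : - ep <= r <= ep by rewrite -ler_norml re.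
  have -> : r * det e es = det e (z + r *: es - z).
    by rewrite /det /= /GRing.scale /=; ring.
  apply: hz.
  - exists (w + r); first by rewrite /=; lra.
    by rewrite -zE; apply: eq_pair2; rewrite /= /GRing.scale /=; ring.
  - by rewrite /= /GRing.scale /= addrC addKr normrM re; lra.
  - by rewrite /= /GRing.scale /= addrC addKr normrM re; lra.
have s1 := side ep (gtr0_norm ep0).
have s2 := side (- ep) ltac:(by rewrite normrN gtr0_norm).
have : ep * (k * det e es) = 0 by lra.
by move/eqP; rewrite !mulf_eq0 (negbTE k0) (gt_eqF ep0) /= => /eqP.
Qed.

Lemma oseg_overlap {R : realType} (a b a' b' z : R * R) (la : R) :
  oseg a b z -> oseg a' b' z -> b' - a' = la *: (b - a) ->
  exists2 ep : R, 0 < ep & oseg z (z + ep *: (b' - a')) `<=` oseg a b `&` oseg a' b'.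
Proof.
move=> [w' /= w'01 zE'] [w /= w01 zE] laE.
pose m := Num.min (Num.min w' (1 - w')) (Num.min w (1 - w)).
have mm0 : 0 < m by rewrite !lt_min; lra.
have mm2 : m <= w by rewrite !ge_min lexx !orbT.
have mm3 : m <= 1 - w by rewrite !ge_min lexx !orbT.
have mm4 : m <= w' by rewrite !ge_min lexx.
have mm5 : m <= 1 - w' by rewrite !ge_min lexx !orbT.
have [ep [ep0 ep1 ep2]] := small_scale mm0 (normr_ge0 la).
exists ep => // _ [r /= /andP[r0 r1] <-].
have r2 : r * ep < m.
  by apply: le_lt_trans ep1; apply: ler_piMl; exact: ltW.
have r3 : 0 < r * ep by rewrite mulr_gt0.
have r4 : `|r * ep * la| < m.
  rewrite !normrM (gtr0_norm ep0) (gtr0_norm r0) -mulrA.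
  by apply: le_lt_trans ep2; apply: ler_piMl; [rewrite mulr_ge0 // ltW|exact: ltW].
split.
  exists (w' + r * ep * la); first by move: r4; rewrite /= ltr_norml; lra.
  by rewrite -zE' laE; apply: eq_pair2; rewrite /= /GRing.scale /=; ring.
exists (w + r * ep); first by rewrite /=; lra.
by rewrite -zE; apply: eq_pair2; rewrite /= /GRing.scale /=; ring.
Qed.

Lemma near_twice {R : realType} (x y z d : R) :
  `|y - z| < d / 2 -> `|x - y| < d / 2 -> `|x - z| < d.
Proof. by have := ler_distD y x z; lra. Qed.

Lemma near_midway {R : realType} (mu n u x z d : R) : 0 < mu -> 0 <= u <= 1 ->
  mu * `|n| < d / 4 -> `|x - (z - mu * n)| < d / 4 ->
  `|x + u * (2 * mu * n) - z| < d / 2.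
Proof.
move=> mu0 u01 h1 h2.
rewrite (_ : _ - z = (x - (z - mu * n)) + (2 * u - 1) * (mu * n)); last by ring.
apply: le_lt_trans (ler_normD _ _) _; rewrite normrM.
have h3 : `|2 * u - 1| <= 1 by rewrite ler_norml; lra.
have h4 : `|mu * n| = mu * `|n| by rewrite normrM gtr0_norm.
have : `|2 * u - 1| * `|mu * n| <= 1 * `|mu * n| by exact: ler_wpM2r.
lra.
Qed.

Section DirichletStart.
Context {R : realType} {Om GD : set (R * R)}.
Hypothesis bO : bounded_set Om.
Hypothesis oO : open Om.

Lemma boundary_closed x : boundary Om x -> closure Om x /\ ~ Om x.
Proof. by rewrite /boundary; have /interior_id -> := oO. Qed.

(* Points facing a Dirichlet edge: translating them by [eta] leaves the domain, and can only
   cross its boundary on that edge, near which the domain lies on one side. *)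
Lemma dirichlet_window (M0 : mesh R) (GN0 : set (R * R)) (s0 : edge M0) :
  admissible M0 Om GD GN0 -> exterior_edge s0 ->
  exists eta U k d, [/\ open U, U !=set0, U `<=` Om & eta != 0] /\
   [/\ k != 0, 0 < d, forall x, U x -> ~ closure Om (x + eta) &
    forall x t, U x -> 0 < t < 1 -> closure Om (x + t *: eta) -> ~ Om (x + t *: eta) ->
     edgeset s0 (x + t *: eta) /\
     forall y, `|y.1 - (x + t *: eta).1| < d -> `|y.2 - (x + t *: eta).2| < d ->
       closure Om y -> 0 <= k * edge_side s0 y].
Proof.
move=> adm0 ex0.
have [C0 s0C] := edge_used adm0 s0.
have [z0 z0s z0v] := oseg_not_in (mesh_vertices (M := M0)) (edge_nondeg adm0 s0).
have /nbhs2P[de de0 hde] := exterior_one_sided adm0 ex0 s0C z0s z0v.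
set c := center C0 in hde; set k := edge_side s0 c in hde.
have Cc : cellset C0 c := center_in adm0 C0.
have k0 : k != 0 := edge_side_cell_neq0 adm0 s0C Cc.
have de2 : 0 < de / 2 by rewrite divr_gt0.
have k2 : 0 < k ^+ 2 by rewrite lt_def sqrf_eq0 k0 sqr_ge0.
set e := edge_vec s0; set a := end1 s0.
pose nu := z0 - c.
have z00 : edge_side s0 z0 = 0 by exact/edge_side_cseg/edgeset_cseg.
have enu : det e nu = - k.
  by rewrite /k -[RHS]add0r -{1}z00 /edge_side /e /nu /det /=; ring.
have B0 : 0 <= 4 * (`|nu.1| + `|nu.2|) by rewrite mulr_ge0 // addr_ge0.
have m0 : 0 < Num.min de 1 by rewrite lt_min de0 ltr01.
have md : Num.min de 1 <= de by rewrite ge_min lexx.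
have m1 : Num.min de 1 <= 1 by rewrite ge_min lexx orbT.
have [mu [mu0 mu1 mu2]] := small_scale m0 B0.
(* The segment from [x0] to [x0 + eta] has midpoint [z0]; [mu] is small enough to keep it in the box
   where the closed domain lies on one side of the edge. *)
pose eta := (2 * mu) *: nu; pose x0 := z0 - mu *: nu.
have n1 : mu * `|nu.1| < de / 4.
  have : 0 <= mu * `|nu.2| by rewrite mulr_ge0 // ltW.
  have : mu * (4 * (`|nu.1| + `|nu.2|)) = 4 * (mu * `|nu.1|) + 4 * (mu * `|nu.2|) by ring.
  lra.
have n2 : mu * `|nu.2| < de / 4.
  have : 0 <= mu * `|nu.1| by rewrite mulr_ge0 // ltW.
  have : mu * (4 * (`|nu.1| + `|nu.2|)) = 4 * (mu * `|nu.1|) + 4 * (mu * `|nu.2|) by ring.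
  lra.
have deta : det e eta = - (2 * mu * k).
  by rewrite -[RHS]mulrN -enu /eta /det /= /GRing.scale /=; ring.
have deta0 : det e eta != 0 by rewrite deta oppr_eq0 !mulf_neq0 // gt_eqF //; lra.
have eta0 : eta != 0 by apply: contraNneq deta0 => ->; rewrite /det /= !mulr0 subrr.
have Cz0 : closure (cellset C0) z0.
  by apply: (edge_boundary adm0 s0C _).1; apply: subset_closure.
have Cx0 : cellset C0 x0.
  rewrite (_ : x0 = c + (1 - mu) *: (z0 - c)).
    by apply: open_convex_segment => //; [exact: (open_cell adm0)|exact: (convex_cell adm0)|lra].
  by apply: eq_pair2; rewrite /x0 /nu /= /GRing.scale /=; ring.
have [u0 /= u01 z0E] := z0s.
have z0E1 := congr1 fst z0E; have z0E2 := congr1 snd z0E; rewrite /= /GRing.scale /= in z0E1 z0E2.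
have x0cross : cross_set a e eta x0.
  split.
    suff -> : cross_abs a e eta x0 = u0 by [].
    apply: (mulIf deta0); rewrite /cross_abs divfK //.
    by rewrite /x0 -z0E /eta /e /a /edge_vec /det /= /GRing.scale /=; ring.
  suff -> : cross_time a e eta x0 = 1 / 2 by lra.
  apply: (mulIf deta0); rewrite /cross_time divfK //.
  by rewrite /x0 -z0E /eta /e /a /edge_vec /det /= /GRing.scale /=; field.
pose box := [set y : R * R | `|y.1 - x0.1| < de / 4 /\ `|y.2 - x0.2| < de / 4].
pose U := (cellset C0 `&` box) `&` cross_set a e eta.
have oU : open U.
  apply: openI; last exact: open_cross_set.
  by apply: openI; [exact: (open_cell adm0)|exact: open_box].
have Ux0 : U x0 by split => //; split => //; split; rewrite /= subrr normr0; lra.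
have inbox x u : U x -> 0 <= u <= 1 ->
    `|(x + u *: eta).1 - z0.1| < de / 2 /\ `|(x + u *: eta).2 - z0.2| < de / 2.
  move=> [[_ [b1 b2]] _] u01'; rewrite /= in b1 b2.
  by split; apply: near_midway.
have sideE x u : edge_side s0 (x + u *: eta) = (u - cross_time a e eta x) * det e eta.
  rewrite edge_side_affine -/e mulrBl /cross_time divfK //.
  by rewrite /edge_side /a -/e /det /=; ring.
(* After the crossing time the point is strictly on the empty side of the edge. *)
have beyond x u : U x -> 0 <= u <= 1 -> closure Om (x + u *: eta) -> u <= cross_time a e eta x.
  move=> Ux u01' cO; have [b1 b2] := inbox x u Ux u01'.
  have := hde _ ltac:(lra) ltac:(lra) cO; rewrite sideE deta.
  have -> : k * ((u - cross_time a e eta x) * - (2 * mu * k)) =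
     (2 * mu * k ^+ 2) * (cross_time a e eta x - u) by ring.
  have p0 : 0 < 2 * mu * k ^+ 2 by rewrite mulr_gt0 //; lra.
  by rewrite pmulr_rge0 ?subr_ge0.
have crosspt x : U x -> edgeset s0 (x + cross_time a e eta x *: eta).
  move=> [_ [ab ti]].
  exists (cross_abs a e eta x) => //=; rewrite -/a -/(edge_vec s0) -/e.
  exact: cross_point.
have UO : U `<=` Om by move=> x [[/(cell_sub adm0)]].
exists eta, U, k, (de / 2); split; first by split => //; exists x0.
split => // [x Ux cO|x t Ux /andP[t0 t1] cz nz].
  have := beyond x 1 Ux; rewrite scale1r ler01 lexx => /(_ isT cO).
  by have [_ [_ /andP[_ ti]]] := Ux; rewrite leNgt ti.
have t01' : 0 <= t <= 1 by rewrite !ltW.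
have tle : t <= cross_time a e eta x := beyond x t Ux t01' cz.
(* Before the crossing time the point is in the open convex cell [C0], hence in the domain. *)
have tE : t = cross_time a e eta x.
  apply/eqP; apply: contrapT => /negP tn.
  have tlt : t < cross_time a e eta x by rewrite lt_neqAle tn.
  have T0 : 0 < cross_time a e eta x := lt_trans t0 tlt.
  have Tn : cross_time a e eta x != 0 by rewrite gt_eqF.
  apply: nz; apply: (cell_sub adm0 (K := C0)).
  rewrite (_ : x + t *: eta = x + (t / cross_time a e eta x) *: ((x + cross_time a e eta x *: eta) - x)).
    apply: open_convex_segment; [exact: (open_cell adm0)|exact: (convex_cell adm0)| | |].
    - by case: Ux => [[]].
    - by apply: (edge_boundary adm0 s0C _).1; apply: subset_closure; exact: crosspt.
    - by rewrite divr_ge0 ?(ltW t0) ?(ltW T0) // ltr_pdivrMr // mul1r.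
  by apply: eq_pair2; rewrite /= /GRing.scale /=; field.
split; first by rewrite tE; exact: crosspt.
have [zb1 zb2] := inbox x t Ux t01'.
by move=> y h1 h2; apply: hde; [exact: near_twice zb1 h1|exact: near_twice zb2 h2].
Qed.

(** In any mesh, the walk from a point of [U] leaves the domain, so it stops on an exterior edge.
    That edge overlaps [s0] along a positive length, so it cannot be a no-flux edge, and the
    Dirichlet estimate of the walk applies. *)
Lemma dirichlet_start (M0 : mesh R) (GN0 : set (R * R)) (s0 : edge M0) :
  admissible M0 Om GD GN0 -> dirichlet_edge GD s0 ->
  exists2 x0, Om x0 & locally_good (Om := Om) (GD := GD) x0.
Proof.
move=> adm0 [ex0 s0D].
have [eta [U [k [d [[oU [x0 Ux0] UO eta0] [k0 d0 Uout Ucross]]]]]] := dirichlet_window adm0 ex0.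
exists x0; first exact: UO.
exists U; last exact: open_nbhs_nbhs.
have mU : measurable (U : set (measurableTypeR R * measurableTypeR R)) by exact: open_measurable2.
have [b b0 hb] := bounded_closure2 bO.
pose bd := 2 * b * (`|eta.1| + `|eta.2|).
have bd0 : 0 <= bd by rewrite !mulr_ge0 // addr_ge0.
split => //; exists bd => // M GN adm bGN zl v.
have mK K : measurable (cellset K : set (measurableTypeR R * measurableTypeR R)) := measurable_cell K adm.
have key : (\sum_K (v K ^+ 2)%:E * lebesgue2 R (U `&` cellset K) <=
    \sum_(K : cell M) 0%:E * lebesgue2 R (U `&` cellset K) + (bd * dissipation GD v)%:E)%E.
  apply: (energy_integral adm eta0) => //.
  - by move=> K; rewrite sqr_ge0.
  - by move=> K; exact: measurableI.
  - by move=> K; exact: measurableI.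
  move=> x /not_exceptional[gx sx sxe].
  have E0 := crossed_energy_ge0 (GD := GD) eta v x 1.
  rewrite [X in _ <= X + _]big1 ?add0r; last by move=> K _; rewrite mul0r.
  have [Ux|Ux] := pselect (U x); last first.
    rewrite big1 ?mulr_ge0 // => K _.
    by rewrite indicE memNset ?mulr0 // => -[].
  have Ox : Om x := UO x Ux.
  have [K Kx] := not_exceptional_cell adm (@subset_closure _ _ _ Ox) sx.
  have nE (s : edge M) : ~ edgeset s (x + 1 *: eta).
    rewrite scale1r => ss; have := sxe s; rewrite edge_side_cseg ?eqxx //; exact: edgeset_cseg.
  have nO : ~ closure Om (x + 1 *: eta) by rewrite scale1r; exact: Uout.
  rewrite (bigD1 K) //= big1 ?addr0; last first.
    move=> L' LL'; rewrite indicE memNset ?mulr0 // => -[_ L'x].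
    by move/eqP: LL'; apply; exact: (cell_unique adm L'x Kx).
  rewrite indicE mem_set ?mulr1 //.
  case: (walk adm v ltr01 gx Kx nE) => [[L [Lx _ _]]|].
    by case: nO; apply/(closure_domain_cell adm); exists L; exact: subset_closure.
  move=> [L [s [t [y [[sL ex t01 sz _] cy w0 wE]]]]].
  suff /wE {}wE : dirichlet_edge GD s.
    apply: le_trans wE _; rewrite mulrC; apply: ler_wpM2r => //.
    apply: dot_diff_le => //; apply: hb => //.
    by apply/(closure_domain_cell adm); exists K; apply: subset_closure; exact: (center_in adm).
  case: (exterior_type adm ex) => // -[_ sN]; exfalso.
  set z := x + t *: eta in sz.
  have sO w : edgeset s w -> closure Om w /\ ~ Om w.
    by move=> sw; apply: boundary_closed; exact: (exterior_boundary adm ex sw).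
  have [cz nz] := sO z sz.
  have [zs0 one_side] := Ucross x t Ux t01 cz nz.
  (* Near [z], an inner point of [s] on the line of [s0], the edge [s] consists of boundary points,
     all on one side of that line; it must be parallel to [s0]. *)
  have par : det (edge_vec s0) (end2 s - end1 s) = 0.
    apply: (oseg_parallel sz d0 k0) => q sq h1 h2.
    have -> : det (edge_vec s0) (q - z) = edge_side s0 q.
      by rewrite -[LHS]addr0 -(edge_side_cseg (edgeset_cseg zs0)) /edge_side /det /=; ring.
    exact: one_side h1 h2 (sO q sq).1.
  have [la laE] : exists la, end2 s - end1 s = la *: (end2 s0 - end1 s0).
    have [la h] := @det_line R 0 (edge_vec s0) (end2 s - end1 s) (edge_vec_neq0 adm0 s0) ltac:(by rewrite subr0).
    by exists la; rewrite h add0r.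
  have es0 : end2 s - end1 s != 0 := edge_vec_neq0 adm s.
  have [ep ep0 epP] := oseg_overlap zs0 sz laE.
  have : zero_length (oseg z (z + ep *: (end2 s - end1 s))).
    by apply: zero_length_subset zl => q /epP[/s0D ? /sN ?].
  move/zero_length_oseg/eqP; rewrite -{1}[z]addr0 (inj_eq (addrI z)) eq_sym scaler_eq0.
  by rewrite (negbTE es0) gt_eqF.
apply: le_trans key _; rewrite big1 ?add0e // => K _; by rewrite mul0e.
Qed.
End DirichletStart.

(** * Discrete Poincare inequality *)

Lemma bounded_measure_fin {R : realType} (A : set (R * R)) (b : R) : 0 <= b ->
  measurable (A : set (measurableTypeR R * measurableTypeR R)) ->
  (forall x, A x -> `|x.1| <= b /\ `|x.2| <= b) -> lebesgue2 R A \is a fin_num.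
Proof.
move=> b0 mA hA; rewrite ge0_fin_numE ?measure_ge0 //.
have b2 : 0 <= 2 * b by lra.
apply: (@le_lt_trans _ _ ((2 * b) * (2 * b))%:E); last exact: ltry.
apply: (@lebesgue2_strip1 R (- b) (2 * b) (2 * b)) => //.
- by move=> x /hA[]; rewrite !ler_norml; lra.
- by move=> x; exists (- b) => y /hA[_]; rewrite /= ler_norml; lra.
Qed.

(** The mesh [M0] covers the closed domain by finitely many closed convex polygons, each of them
    good, and [C] is fixed before [M]. *)
Lemma poincare {R : realType} (Om GD GN0 : set (R * R)) (M0 : mesh R) (s0 : edge M0) :
  open Om -> connected Om -> bounded_set Om ->
  admissible M0 Om GD GN0 -> dirichlet_edge GD s0 ->
  exists2 C : R, 0 < C &
  forall (M : mesh R) (GN : set (R * R)), admissible M Om GD GN ->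
  boundary Om = GD `|` GN -> zero_length (GD `&` GN) -> forall v : cell M -> R,
  \sum_K cell_area K * v K ^+ 2 <= C * dissipation GD v.
Proof.
move=> oO cO bO adm0 ds0.
have [x0 Ox0 g0] := dirichlet_start bO oO adm0 ds0.
have gO : good (Om := Om) (GD := GD) (closure Om).
  apply: (@good_subset _ _ _ _ (\big[setU/set0]_(K : cell M0) closure (cellset K))).
  - by apply: closed_measurable2; exact: closed_closure.
  - by move=> x /(closure_domain_cell adm0)[K cx]; rewrite (bigD1 K) //=; left.
  apply: good_bigU => K _; apply: (good_cell adm0 bO).
  apply: (good_connected bO oO cO Ox0 g0).
  exact: (cell_sub adm0 (center_in adm0 K)).
have [mO [C C0 hC]] := gO.
exists (C + 1); first by lra.
move=> M GN adm bGN zl v.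
have [b b0 hb] := bounded_closure2 bO.
have D0 := dissipation_ge0 (GD := GD) v.
suff : \sum_K cell_area K * v K ^+ 2 <= C * dissipation GD v by lra.
rewrite -lee_fin; apply: le_trans (hC M GN adm bGN zl v); rewrite -sumEFin.
apply: lee_sum => K _.
have mK := measurable_cell K adm.
have KO : cellset K `<=` closure Om.
  by move=> x Kx; apply: subset_closure; exact: (cell_sub adm Kx).
rewrite (_ : closure Om `&` cellset K = cellset K); last exact: setIidr.
rewrite mulrC EFinM /cell_area fineK //.
by apply: (bounded_measure_fin b0) => // x /KO; exact: hb.
Qed.

(** * Entropy dissipation *)

Section PowerInequalities.
Context {R : realType}.
Implicit Types (a p s t x y : R).

(** Young's inequality for t^a and 1, with exponents 1/a and 1/(1 - a). *)
Lemma powR_le_tangent a t : 0 < a <= 1 -> 0 <= t -> t `^ a <= 1 + a * (t - 1).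
Proof.
move=> /andP[a0 a1] t0; have [->|an] := eqVneq a 1.
  by rewrite powRr1 //; lra.
have a1' : 0 < 1 - a by rewrite subr_gt0 lt_neqAle an.
have := @conjugate_powR R (t `^ a) 1 a^-1 (1 - a)^-1 (powR_ge0 _ _) ler01.
rewrite !invrK !invr_gt0 => /(_ a0 a1' ltac:(by ring)).
rewrite mulr1 -powRrM mulfV ?gt_eqF // powRr1 // powR1; lra.
Qed.

(** The concave case with exponent 1/q, applied at y^q. *)
Lemma powR_ge_tangent q y : 1 <= q -> 0 <= y -> 1 + q * (y - 1) <= y `^ q.
Proof.
move=> q1 y0; have q0 : 0 < q by lra.
have qi : 0 < q^-1 <= 1 by rewrite invr_gt0 q0 invf_le1.
have := powR_le_tangent qi (powR_ge0 y q).
rewrite -powRrM mulfV ?gt_eqF // powRr1 // => h.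
have : q * y <= q * (1 + q^-1 * (y `^ q - 1)) by rewrite ler_pM2l.
rewrite mulrDr mulr1 mulrA mulfV ?gt_eqF // mul1r; lra.
Qed.

Variable p : R.
Hypothesis p12 : 1 < p <= 2.

Lemma Phi_ge0 s : 0 <= s -> 0 <= Phi p s.
Proof.
have [p1' p2'] := andP p12; move=> s0; have h := @powR_ge_tangent p s ltac:(lra) s0.
have p1 : 0 < p - 1 by lra.
rewrite /Phi (_ : _ + 1 = (s `^ p - p * s + (p - 1)) / (p - 1)).
  by rewrite divr_ge0 //; lra.
by field; rewrite gt_eqF.
Qed.

(** With z = s^(p/2), the claim z^2 - p s + p - 1 <= (z - 1)^2 is the tangent inequality for s =
    z^(2/p), where 2/p >= 1. *)
Lemma Phi_le s : 0 <= s -> Phi p s <= (s `^ (p / 2) - 1) ^+ 2 / (p - 1).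
Proof.
have [p1' p2'] := andP p12; move=> s0; have p0 : 0 < p by lra.
have p1 : 0 < p - 1 by lra.
have q1 : 1 <= 2 / p by rewrite ler_pdivlMr //; lra.
have h := @powR_ge_tangent (2 / p) (s `^ (p / 2)) q1 (powR_ge0 _ _).
rewrite -powRrM (_ : p / 2 * (2 / p) = 1) ?powRr1 // in h; last by field; rewrite gt_eqF.
have h2 : (s `^ (p / 2)) ^+ 2 = s `^ p.
  rewrite -powR_mulrn ?powR_ge0 // -powRrM; congr (_ `^ _); by field.
have h3 : p * s >= p + 2 * (s `^ (p / 2) - 1).
  have : p * (1 + 2 / p * (s `^ (p / 2) - 1)) <= p * s by rewrite ler_pM2l.
  by rewrite mulrDr mulr1 mulrA (_ : p * (2 / p) = 2) //; field; rewrite gt_eqF.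
rewrite /Phi (_ : _ + 1 = (s `^ p - p * s + (p - 1)) / (p - 1)); last by field; rewrite gt_eqF.
rewrite ler_pM2r ?invr_gt0 //.
by rewrite sqrrB1 h2; lra.
Qed.

Definition dPhi (s : R) : R := p / (p - 1) * (s `^ (p - 1) - 1).

(** Tangent inequality for the power at [s / t], multiplied by t^p. The case s = 0 is included
    because the initial datum may vanish on a cell. *)
Lemma Phi_convex s t : 0 <= s -> 0 < t -> Phi p t - Phi p s <= dPhi t * (t - s).
Proof.
have [p1' p2'] := andP p12; move=> s0 t0; have p1 : 0 < p - 1 by lra.
have h := @powR_ge_tangent p (s / t) ltac:(lra) ltac:(by rewrite divr_ge0 // ltW).
have tp : 0 < t `^ p by rewrite powR_gt0.
have tE : t `^ p = t * t `^ (p - 1) by rewrite mulr_powRB1 //; lra.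
have {}h : t `^ p + p * t `^ (p - 1) * (s - t) <= s `^ p.
  have : t `^ p * (1 + p * (s / t - 1)) <= t `^ p * (s / t) `^ p by rewrite ler_pM2l.
  have -> : t `^ p * (s / t) `^ p = s `^ p.
    rewrite -powRM ?(ltW t0) ?divr_ge0 ?(ltW t0) //.
    by congr (_ `^ _); field; rewrite gt_eqF.
  suff -> : t `^ p * (1 + p * (s / t - 1)) = t `^ p + p * t `^ (p - 1) * (s - t) by [].
  by rewrite tE; field; rewrite gt_eqF.
rewrite /Phi /dPhi -(ler_pM2r p1).
rewrite (_ : (_ - _) * (p - 1) = (t `^ p - p * t) - (s `^ p - p * s)); last by field; rewrite gt_eqF.
rewrite (_ : _ * (p - 1) = p * (t `^ (p - 1) - 1) * (t - s)); last by field; rewrite gt_eqF.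
lra.
Qed.

(** By symmetry and homogeneity, y = x t with t <= 1. Then t^(p/2) >= t since p <= 2, and 1 -
    t^(p-1) >= (p - 1) (1 - t) by concavity: both sides are compared with (p - 1) (1 - t)^2. *)
Lemma powR_gradient x y : 0 < x -> 0 < y ->
  (p - 1) * (x `^ (p / 2) - y `^ (p / 2)) ^+ 2 <= (x - y) * (x `^ (p - 1) - y `^ (p - 1)).
Proof.
have [p1' p2'] := andP p12; wlog : x y / y <= x => [hw x0 y0|yx x0 y0].
  have [yx|/ltW xy] := leP y x; first exact: hw.
  have := hw y x xy y0 x0.
  have -> : (y `^ (p / 2) - x `^ (p / 2)) ^+ 2 = (x `^ (p / 2) - y `^ (p / 2)) ^+ 2 by ring.
  by have -> : (y - x) * (y `^ (p - 1) - x `^ (p - 1)) = (x - y) * (x `^ (p - 1) - y `^ (p - 1)) by ring.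
have [t yE] : exists t, y = x * t by exists (y / x); field; rewrite gt_eqF.
have t0 : 0 < t by move: y0; rewrite yE pmulr_rgt0.
have t1 : t <= 1 by move: yx; rewrite yE ger_pMr.
have a1 := @powR_le_tangent (p - 1) t ltac:(lra) (ltW t0).
have a2 : t <= t `^ (p / 2) by apply: ger1_powR; lra.
have a3 : t `^ (p / 2) <= 1.
  have := @ger_powR _ t ltac:(by rewrite t0) 0 (p / 2); rewrite powRr0; apply; lra.
rewrite yE !powRM ?(ltW x0) ?(ltW t0) //.
have X2 : (x `^ (p / 2)) ^+ 2 = x `^ p.
  rewrite -powR_mulrn ?powR_ge0 // -powRrM; congr (_ `^ _); by field.
have X1 : x * x `^ (p - 1) = x `^ p by rewrite mulr_powRB1 ?(ltW x0) //; lra.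
rewrite (_ : (_ - _ * _) ^+ 2 = (x `^ (p / 2)) ^+ 2 * (1 - t `^ (p / 2)) ^+ 2); last by ring.
rewrite (_ : (x - _) * _ = (x * x `^ (p - 1)) * ((1 - t) * (1 - t `^ (p - 1)))); last by ring.
rewrite X1 X2 mulrCA ler_pM2l ?powR_gt0 //.
have b1 : (1 - t `^ (p / 2)) ^+ 2 <= (1 - t) ^+ 2 by rewrite ler_sqr ?nnegrE; lra.
apply: (@le_trans _ _ ((p - 1) * (1 - t) ^+ 2)); first by rewrite ler_pM2l; lra.
rewrite expr2 mulrCA; apply: ler_wpM2l; lra.
Qed.

(** The bound by the logarithmic mean says that r (ln x - ln y) has the sign of x - y and at least
    its size; the other factor has that sign too. *)
Lemma mean_gradient (r : R -> R -> R) x y : admissible_mean r -> 0 < x -> 0 < y ->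
  (p - 1) * (x `^ (p / 2) - y `^ (p / 2)) ^+ 2 <=
  r x y * (ln x - ln y) * (x `^ (p - 1) - y `^ (p - 1)).
Proof.
have [p1' p2'] := andP p12; move=> mr x0 y0; apply: le_trans (powR_gradient x0 y0) _.
have [->|xy] := eqVneq x y; first by rewrite !subrr !mulr0.
have [lb _] := andP (mean_bounds mr x0 y0 xy).
have [lxy|lyx] := ltP x y.
  have l0 : ln x - ln y < 0 by rewrite subr_lt0 ltr_ln.
  have w0 : x `^ (p - 1) - y `^ (p - 1) <= 0.
    by rewrite subr_le0 ge0_ler_powR ?nnegrE ?ltW //; lra.
  by apply: ler_wnM2r => //; rewrite -ler_ndivrMr.
have lyx' : y < x by rewrite lt_neqAle eq_sym xy.
have l0 : 0 < ln x - ln y by rewrite subr_gt0 ltr_ln.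
have w0 : 0 <= x `^ (p - 1) - y `^ (p - 1).
  by rewrite subr_ge0 ge0_ler_powR ?nnegrE ?ltW //; lra.
by apply: ler_wpM2r => //; rewrite -ler_pdivrMr.
Qed.

(** Bernoulli's inequality for (1 + ka k)^(dt/k), whose exponent is at most 1. *)
Lemma exp_interpolation (ka k dt : R) : 0 < ka -> 0 < k -> 0 < dt <= k ->
  expR (ln (1 + ka * k) / k * dt) <= 1 + ka * dt.
Proof.
move=> ka0 k0 /andP[dt0 dtk].
have kk : 0 < ka * k by rewrite mulr_gt0.
have a01 : 0 < dt / k <= 1 by rewrite divr_gt0 //= ler_pdivrMr // mul1r.
have := @powR_le_tangent (dt / k) (1 + ka * k) a01 ltac:(lra).
rewrite /powR gt_eqF; last lra.
rewrite (_ : dt / k * ln _ = ln (1 + ka * k) / k * dt); last by ring.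
by rewrite (_ : dt / k * (1 + ka * k - 1) = ka * dt) //; field; rewrite gt_eqF.
Qed.
End PowerInequalities.

Section EdgeBound.
Context {R : realType}.
Variables (p : R) (r : R -> R -> R).
Hypothesis p12 : 1 < p <= 2.
Hypothesis mr : admissible_mean r.

Lemma mean_weighted (c a b x y : R) : 0 < c -> c <= a -> c <= b -> 0 < x -> 0 < y ->
  c * r x y <= r (a * x) (b * y).
Proof.
move=> c0 ca cb x0 y0; rewrite -(mean_homog mr) //.
have cx : 0 < c * x by rewrite mulr_gt0.
have cy : 0 < c * y by rewrite mulr_gt0.
have ax : c * x <= a * x by rewrite ler_pM2r.
have bY : c * y <= b * y by rewrite ler_pM2r.
apply: le_trans (mean_mono1 mr cx ax cy) _.
by apply: (mean_mono2 mr) => //; exact: lt_le_trans ax.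
Qed.

Lemma ln_powR_mono (x y : R) : 0 < x -> 0 < y ->
  0 <= (ln x - ln y) * (x `^ (p - 1) - y `^ (p - 1)).
Proof.
have [p1 p2] := andP p12.
wlog : x y / y <= x => [hw x0 y0|yx x0 y0].
  have [yx|/ltW xy] := leP y x; first exact: hw.
  by have := hw y x xy y0 x0; rewrite -mulrNN !opprB.
rewrite mulr_ge0 // subr_ge0 ?ler_ln //.
by rewrite ge0_ler_powR ?nnegrE ?(ltW x0) ?(ltW y0) //; lra.
Qed.

(** The factor p - 1 of [mean_gradient] cancels the denominator of [dPhi]. The weights [a], [b]
    stand for steady-state values, with common lower bound [c]. *)
Lemma edge_bound (c a b x y : R) : 0 < c -> c <= a -> c <= b -> 0 < x -> 0 < y ->
  c * p * (x `^ (p / 2) - y `^ (p / 2)) ^+ 2 <=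
  r (a * x) (b * y) * (ln x - ln y) * (dPhi p x - dPhi p y).
Proof.
move=> c0 ca cb x0 y0; have [p1 p2] := andP p12.
have pp : 0 < p / (p - 1) by rewrite divr_gt0; lra.
have -> : dPhi p x - dPhi p y = p / (p - 1) * (x `^ (p - 1) - y `^ (p - 1)).
  by rewrite /dPhi; ring.
have h1 := mean_gradient p12 mr x0 y0.
have h2 := mean_weighted c0 ca cb x0 y0.
have h3 := ln_powR_mono x0 y0.
set D := (_ - _) ^+ 2 in h1 *.
set l := ln x - ln y in h1 h3 *; set g := x `^ (p - 1) - y `^ (p - 1) in h1 h3 *.
rewrite [leRHS]mulrCA -[r _ _ * l * g]mulrA.
have h4 : c * r x y * (l * g) <= r (a * x) (b * y) * (l * g) by exact: ler_wpM2r.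
have h5 : c * ((p - 1) * D) <= c * (r x y * l * g) by rewrite ler_pM2l.
have h6 : p / (p - 1) * (c * ((p - 1) * D)) <= p / (p - 1) * (r (a * x) (b * y) * (l * g)).
  rewrite ler_pM2l //; lra.
apply: le_trans h6.
have -> : p / (p - 1) * (c * ((p - 1) * D)) = c * p * D by field; rewrite gt_eqF //; lra.
by [].
Qed.
End EdgeBound.

(** * Entropy balance of one time step *)

Section EntropyDissipation.
Context {R : realType} {M : mesh R} {Om GD GN : set (R * R)}.
Hypothesis adm : admissible M Om GD GN.
Variables (V : R * R -> R) (rho p : R) (r : R -> R -> R).
Hypothesis rho0 : 0 < rho.
Hypothesis p12 : 1 < p <= 2.
Hypothesis mr : admissible_mean r.
Variable Vm : R.
Hypothesis VmP : forall x, closure Om x -> `|V x| <= Vm.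
Implicit Types (K L : cell M) (s : edge M).
Local Notation uinf := (uinf V rho).

Definition relative_density (u : cell M -> R) K : R := u K / uinf K.

(** The same edge seen from its other side; exterior edges are fixed. *)
Definition twin (i : cell M * edge M) : cell M * edge M :=
  if neighbor i.1 i.2 is Some L then (L, i.2) else i.

Lemma twinK : involutive twin.
Proof.
move=> [K s]; rewrite /twin /=; case nb : (neighbor K s) => [L|] /=; last by rewrite nb.
by have /eqP -> : neighbor L s == Some K by rewrite -(neighbor_sym adm) nb.
Qed.

Lemma twin_edges i : ((twin i).2 \in edges_of (twin i).1) = (i.2 \in edges_of i.1).
Proof.
case: i => K s; rewrite /twin /=; case nb : (neighbor K s) => [L|] //=.
have : neighbor K s == Some L by rewrite nb.
by rewrite (neighbor_separates adm) => /asboolP[_ -> ->].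
Qed.

(** Discrete integration by parts: opposite fluxes on an interior edge turn the symmetrized summand
    into a flux times a difference. *)
Lemma sum_twin (f : cell M -> edge M -> R) :
  \sum_K \sum_(s in edges_of K) f K s =
  2^-1 * \sum_K \sum_(s in edges_of K) (f K s + f (twin (K, s)).1 (twin (K, s)).2).
Proof.
rewrite !(pair_big_dep xpredT (fun K s => s \in edges_of K)) /=.
rewrite big_split /= [X in _ = _ * (_ + X)](_ : _ = \sum_(i | i.2 \in edges_of i.1) f i.1 i.2).
  by field.
rewrite [RHS](reindex_inj (inv_inj twinK)) /=.
by apply: eq_big => [i|[K s] _] //; rewrite twin_edges.
Qed.

Lemma uinf_gt0 K : 0 < uinf K.
Proof. by rewrite mulr_gt0 // expR_gt0. Qed.

Lemma uD_bounds x : closure Om x ->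
  rho * expR (- Vm) <= uD V rho x <= rho * expR Vm.
Proof.
move=> /VmP; rewrite ler_norml /uD => /andP[h1 h2].
by rewrite !ler_pM2l // !ler_expR; lra.
Qed.

Lemma uinf_bounds K : rho * expR (- Vm) <= uinf K <= rho * expR Vm.
Proof.
by apply: uD_bounds; apply: subset_closure; exact: (cell_sub adm (center_in adm K)).
Qed.

(** Since the steady state is a multiple of e^(-V), the potential driving the flux is the logarithm
    of the relative density, up to a constant. *)
Lemma ln_relative_density (u : cell M -> R) K : 0 < u K ->
  ln (u K) + V (center K) = ln (relative_density u K) + ln rho.
Proof.
move=> uK; rewrite /relative_density ln_div ?posrE ?uinf_gt0 //.
by rewrite lnM ?posrE ?expR_gt0 // expRK; ring.
Qed.

Lemma transm_ge0 K s : 0 <= transm K s.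
Proof.
rewrite divr_ge0 ?sqrtr_ge0 // /edge_dist /dist_to_edge.
by case: neighbor => [L|]; exact: sqrtr_ge0.
Qed.

Lemma flux_dissipation (u : cell M -> R) : (forall K, 0 < u K) ->
  2^-1 * (rho * expR (- Vm) * p) *
    dissipation GD (fun K => relative_density u K `^ (p / 2) - 1) <=
  \sum_K dPhi p (relative_density u K) * \sum_(s in edges_of K) flux GD V rho r u K s.
Proof.
move=> u0; set w := relative_density u; set v := fun K => _.
have w0 K : 0 < w K by rewrite divr_gt0 // uinf_gt0.
have uw K : u K = uinf K * w K.
  by rewrite /w /relative_density mulrCA mulfV ?mulr1 // gt_eqF // uinf_gt0.
have c0 : 0 < rho * expR (- Vm) by rewrite mulr_gt0 // expR_gt0.
have cK K : rho * expR (- Vm) <= uinf K by have /andP[] := uinf_bounds K.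
under [leRHS]eq_bigr do rewrite mulr_sumr.
rewrite (sum_twin (fun K s => dPhi p (w K) * flux GD V rho r u K s)) -mulrA ler_pM2l ?invr_gt0 //.
rewrite mulr_sumr; apply: ler_sum => K _; rewrite mulr_sumr; apply: ler_sum => s sK.
rewrite mulrCA /jump /twin /=; case nb : (neighbor K s) => [L|] /=.
  have nb' : neighbor L s = Some K by apply/eqP; rewrite -(neighbor_sym adm) nb.
  have tE : transm L s = transm K s.
    by rewrite /transm /edge_dist nb nb' enormB.
  have FK : flux GD V rho r u K s = transm K s * (r (u K) (u L) * (ln (w K) - ln (w L))).
    rewrite /flux nb.
    have -> : ln (u L) + V (center L) - ln (u K) - V (center K) =
      (ln (u L) + V (center L)) - (ln (u K) + V (center K)) by ring.
    by rewrite !ln_relative_density //; ring.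
  have FL : flux GD V rho r u L s = - (transm K s * (r (u K) (u L) * (ln (w K) - ln (w L)))).
    rewrite /flux nb' tE (mean_sym mr) //.
    have -> : ln (u K) + V (center K) - ln (u L) - V (center L) =
      (ln (u K) + V (center K)) - (ln (u L) + V (center L)) by ring.
    by rewrite !ln_relative_density //; ring.
  rewrite FK FL.
  have alg (x y t q : R) : x * (t * q) + y * - (t * q) = t * (q * (x - y)) by ring.
  rewrite alg; apply: ler_wpM2l; first exact: transm_ge0.
  have -> : v L - v K = - (w K `^ (p / 2) - w L `^ (p / 2)).
    have algv (x y : R) : y - 1 - (x - 1) = - (x - y) by ring.
    exact: algv.
  by rewrite sqrrN !uw; apply: edge_bound.
rewrite /flux nb; case: asboolP => [ds|_]; last by rewrite expr0n /= !mulr0 addr0.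
have mid : closure Om (midpoint s).
  apply/(closure_domain_cell adm); exists K.
  apply: (edge_boundary adm sK _).1; apply: subset_closure; exists (1 / 2) => /=; first lra.
  by apply: eq_pair2; rewrite /= /GRing.scale /=; field.
have /andP[cs _] := uD_bounds mid.
set us := uD V rho (midpoint s) in cs *.
have us0 : 0 < us by exact: lt_le_trans cs.
have lus : ln us + V (midpoint s) = ln rho.
  by rewrite /us /uD lnM ?posrE ?expR_gt0 // expRK; ring.
have -> : - transm K s * r (u K) us * (ln us + V (midpoint s) - ln (u K) - V (center K)) =
   transm K s * (r (u K) us * (ln (w K) - ln 1)).
  have -> : ln us + V (midpoint s) - ln (u K) - V (center K) =
    (ln us + V (midpoint s)) - (ln (u K) + V (center K)) by ring.
  by rewrite lus ln_relative_density // ln1; ring.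
(* The Dirichlet value has relative density 1, where [dPhi] vanishes, so the single term of a
   boundary edge is already a difference. *)
have d1 : dPhi p 1 = 0 by rewrite /dPhi powR1 subrr mulr0.
have eb : rho * expR (- Vm) * p * (w K `^ (p / 2) - 1 `^ (p / 2)) ^+ 2 <=
    r (u K) us * (ln (w K) - ln 1) * (dPhi p (w K) - dPhi p 1).
  by rewrite {1}uw -{1}[us]mulr1; apply: edge_bound.
rewrite powR1 d1 subr0 in eb.
have -> : dPhi p (w K) * (transm K s * (r (u K) us * (ln (w K) - ln 1))) =
   transm K s * (r (u K) us * (ln (w K) - ln 1) * dPhi p (w K)) by ring.
rewrite -mulrDr; apply: ler_wpM2l; first exact: transm_ge0.
(* Symmetrization counted the exterior edge twice; one copy suffices and the other is
   nonnegative. *)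
rewrite /v -/w sqrrN; apply: le_trans (eb) _; rewrite lerDl.
apply: le_trans eb; apply: mulr_ge0; last exact: sqr_ge0.
by apply: mulr_ge0; [exact: ltW|have /andP[p1 _] := p12; lra].
Qed.

(** Convexity at the new time bounds the entropy change by the scheme's dissipation. The rate is the
    quotient of its lower constant rho e^(-Vm) p / 2 by the constant rho e^Vm C / (p - 1) that
    bounds the entropy through the Poincare inequality. *)
Lemma entropy_step (C dt : R) (u0 u1 : cell M -> R) : 0 < C -> 0 < dt ->
  (forall v : cell M -> R, \sum_K cell_area K * v K ^+ 2 <= C * dissipation GD v) ->
  (forall K, 0 <= u0 K) -> (forall K, 0 < u1 K) ->
  (forall K, cell_area K * ((u1 K - u0 K) / dt) +
      \sum_(s in edges_of K) flux GD V rho r u1 K s = 0) ->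
  (1 + expR (- Vm) / expR Vm * (p * (p - 1) / (2 * C)) * dt) * entropy V rho p u1 <=
  entropy V rho p u0.
Proof.
move=> C0 dt0 poin u00 u10 step; have [p1 p2] := andP p12.
have pm : 0 < p - 1 by lra.
have dtn : dt != 0 by rewrite gt_eqF.
have area0 K : 0 <= cell_area K by rewrite fine_ge0.
set w := relative_density u1; set v := fun K => w K `^ (p / 2) - 1.
have w0 K : 0 < w K by rewrite divr_gt0 // uinf_gt0.
have fd := flux_dissipation u10; rewrite -/w -/v in fd.
have D0 := dissipation_ge0 (GD := GD) v.
have E1 : entropy V rho p u1 <= rho * expR Vm / (p - 1) * (C * dissipation GD v).
  apply: (@le_trans _ _ (rho * expR Vm / (p - 1) * \sum_K cell_area K * v K ^+ 2)).
    rewrite mulr_sumr; apply: ler_sum => K _.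
    have h1 := Phi_le p12 (ltW (w0 K)); rewrite -/(v K) in h1.
    have /andP[_ ub] := uinf_bounds K.
    rewrite -mulrA [leRHS]mulrCA; apply: ler_wpM2l => //.
    apply: (@le_trans _ _ (uinf K * (v K ^+ 2 / (p - 1)))).
      by rewrite ler_pM2l // uinf_gt0.
    rewrite (_ : rho * expR Vm / (p - 1) * v K ^+ 2 = rho * expR Vm * (v K ^+ 2 / (p - 1))); last by ring.
    by apply: ler_wpM2r => //; rewrite divr_ge0 ?sqr_ge0 // ltW.
  by rewrite ler_wpM2l // divr_ge0 ?mulr_ge0 ?expR_ge0 // ltW.
have E2 : entropy V rho p u1 - entropy V rho p u0 <=
    - dt * \sum_K dPhi p (w K) * \sum_(s in edges_of K) flux GD V rho r u1 K s.
  rewrite -sumrB mulr_sumr; apply: ler_sum => K _.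
  have sE : cell_area K * (u1 K - u0 K) = - dt * \sum_(s in edges_of K) flux GD V rho r u1 K s.
    have := step K; set S := \sum_(_ in _) _ => h.
    have -> : S = - (cell_area K * ((u1 K - u0 K) / dt)) by lra.
    by field.
  rewrite [leRHS]mulrCA -sE -mulrBr -mulrA [leRHS]mulrCA; apply: ler_wpM2l => //.
  have cv := Phi_convex p12 (_ : 0 <= u0 K / uinf K) (w0 K).
  have u0g : 0 <= u0 K / uinf K by rewrite divr_ge0 // ltW // uinf_gt0.
  have {}cv : uinf K * (Phi p (w K) - Phi p (u0 K / uinf K)) <=
      uinf K * (dPhi p (w K) * (w K - u0 K / uinf K)).
    by rewrite ler_pM2l ?uinf_gt0 //; exact: cv.
  apply: le_trans cv _.
  rewrite mulrCA le_eqVlt; apply/orP; left; apply/eqP; congr (_ * _).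
  rewrite /w /relative_density; field; rewrite gt_eqF // uinf_gt0 //.
set ka := expR (- Vm) / expR Vm * (p * (p - 1) / (2 * C)).
have ka0 : 0 < ka by rewrite /ka !mulr_gt0 ?invr_gt0 ?expR_gt0 //; lra.
have en : expR Vm != 0 by rewrite gt_eqF // expR_gt0.
have h1 : ka * entropy V rho p u1 <= 2^-1 * (rho * expR (- Vm) * p) * dissipation GD v.
  have -> : 2^-1 * (rho * expR (- Vm) * p) * dissipation GD v =
      ka * (rho * expR Vm / (p - 1) * (C * dissipation GD v)).
    by rewrite /ka; field; rewrite en !gt_eqF.
  by rewrite ler_pM2l.
have h2 : dt * (ka * entropy V rho p u1) <=
    dt * \sum_K dPhi p (w K) * \sum_(s in edges_of K) flux GD V rho r u1 K s.
  by rewrite ler_pM2l //; exact: le_trans fd.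
rewrite mulrDl mul1r -mulrA mulrCA.
set S := \sum_K _ in E2 h2; lra.
Qed.

Lemma entropy_ge0 (u : cell M -> R) : (forall K, 0 <= u K) -> 0 <= entropy V rho p u.
Proof.
move=> u0; apply: sumr_ge0 => K _; rewrite mulr_ge0 ?(Phi_ge0 p12) //.
  by rewrite mulr_ge0 ?fine_ge0 // ltW // uinf_gt0.
by rewrite divr_ge0 // ltW // uinf_gt0.
Qed.
End EntropyDissipation.

(** * Decay of the relative entropies *)

Lemma continuous_closure_bounded {R : realType} (Om : set (R * R)) (V : R * R -> R) :
  bounded_set Om -> {within closure Om, continuous V} ->
  exists Vm, forall x, closure Om x -> `|V x| <= Vm.
Proof.
move=> bO cV; have [b b0 hb] := bounded_closure2 bO.
have cO : compact (closure Om).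
  apply: (@subclosed_compact _ _ (`[-b, b]%classic `*` `[-b, b]%classic)).
  - exact: closed_closure.
  - by apply: compact_setX; exact: segment_compact.
  - by move=> x /hb[]; rewrite !ler_norml => h1 h2; split; rewrite /= in_itv.
have [m [_ hm]] := compact_bounded (continuous_compact cV cO).
exists (m + 1) => x cx; apply: (hm (m + 1)); first by lra.
by exists x.
Qed.

(** Almost everywhere on [A], [f] equals its absolute value. Measurability on [A] comes from the
    extension of [f] by 0 that [L2] speaks of. *)
Lemma ae_nonneg_Rintegral_ge0 {R : realType} (A Om : set (R * R)) (f : R * R -> R) :
  measurable (A : set (measurableTypeR R * measurableTypeR R)) -> A `<=` Om ->
  L2 Om f -> {ae lebesgue2 R, forall x, Om x -> 0 <= f x} ->
  0 <= (\int[lebesgue2 R]_(x in A) f x)%R.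
Proof.
move=> mA AO fL f0; rewrite /Rintegral fine_ge0 //.
have mf : measurable_fun (A : set (measurableTypeR R * measurableTypeR R)) f.
  apply: (@eq_measurable_fun _ _ _ _ _ (patch (fun=> 0) Om f)).
    by move=> x; rewrite inE => /AO Ox; rewrite patchE mem_set.
  have /andP[] := fL; rewrite inE /= => mp _.
  exact: measurable_funS mp.
rewrite (@ae_eq_integral _ _ _ (lebesgue2 R) A
  (fun x : measurableTypeR R * measurableTypeR R => `|f x|%:E)) //.
- by apply: integral_ge0 => x _; rewrite lee_fin.
- exact/measurable_EFinP.
- by apply/measurable_EFinP; exact: measurableT_comp.
- case: f0 => N [mN N0 sub]; exists N; split => // x nx; apply: sub => h.
  by apply: nx => /AO/h h0; rewrite ger0_norm.
Qed.

Unset Implicit Arguments.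

Theorem theorem3p3 (R : realType) (Om GD : set (R * R)) (V : R * R -> R)
    (rho zeta p : R) :
  polygonal_domain Om ->
  C1_closure Om V ->
  0 < rho -> 0 < zeta -> 1 < p <= 2 ->
  exists kappa : R, 0 < kappa /\
    forall (GN : set (R * R)) (M : mesh R) (r : R -> R -> R)
      (u0 : R * R -> R) (dt : R) (u : nat -> cell M -> R),
    boundary Om = GD `|` GN ->
    zero_length (GD `&` GN) ->
    admissible M Om GD GN ->
    regular M zeta ->
    (exists s : edge M, dirichlet_edge GD s) ->
    admissible_mean r ->
    L2 Om u0 ->
    {ae lebesgue2 R, forall x, Om x -> 0 <= u0 x} ->
    0 < dt ->
    solution GD V rho r u0 dt u ->
    forall k : R, 0 < k -> dt <= k ->
    (forall n : nat,
       entropy V rho p (u n) <=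
         (1 + kappa * dt) ^- n * entropy V rho p (u 0%N)) /\
    (forall n : nat,
       entropy V rho p (u n) <=
         expR (- (ln (1 + kappa * k) / k) * (n%:R * dt)) *
           entropy V rho p (u 0%N)).
Proof.
move=> [oO cO bO _] [cV _] rho0 _ p12.
(* The reference mesh must be chosen before [kappa]. If no admissible mesh has a Dirichlet edge, the
   claim is vacuous and any positive constant does. *)
have [[GN0 [M0 [s0 [adm0 ds0]]]]|none] := pselect (exists GN0 (M0 : mesh R) (s0 : edge M0),
    admissible M0 Om GD GN0 /\ dirichlet_edge GD s0); last first.
  exists 1; split => // GN M r u0 dt u _ _ adm _ [s ds].
  by case: none; exists GN, M, s.
have [C C0 poin] := poincare oO cO bO adm0 ds0.
have [Vm VmP] := continuous_closure_bounded bO cV.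
pose kappa := expR (- Vm) / expR Vm * (p * (p - 1) / (2 * C)).
have kappa0 : 0 < kappa.
  have [p1 p2] := andP p12.
  by rewrite /kappa !mulr_gt0 ?invr_gt0 ?mulr_gt0 ?expR_gt0 //; lra.
exists kappa; split => // GN M r u0 dt u bGN zl adm _ _ mr uL2 u0ge dt0 sol k k0 dtk.
have unn n K : 0 <= u n K.
  case: n => [|n]; last by rewrite ltW // (sol_pos sol).
  rewrite (sol_init sol); apply: mulr_ge0; first by rewrite invr_ge0 fine_ge0.
  apply: (@ae_nonneg_Rintegral_ge0 _ _ Om) => //; last exact: (cell_sub adm).
  exact: measurable_cell K adm.
have step n : (1 + kappa * dt) * entropy V rho p (u n.+1) <= entropy V rho p (u n).
  apply: (entropy_step adm rho0 p12 mr VmP C0 dt0 (poin M GN adm bGN zl)) => [//|K|K].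
    exact: (sol_pos sol).
  exact: (sol_step sol).
have d0 : 0 < 1 + kappa * dt by rewrite addr_gt0 // mulr_gt0.
have decay n : entropy V rho p (u n) <= (1 + kappa * dt) ^- n * entropy V rho p (u 0%N).
  elim: n => [|n IH]; first by rewrite expr0 invr1 mul1r.
  rewrite exprS invfM -mulrA ler_pdivlMl //.
  exact: le_trans (step n) IH.
split => // n; apply: le_trans (decay n) _.
apply: ler_wpM2r; first exact: (entropy_ge0 V rho0 p12 (unn 0%N)).
(* Writing the exponential as an inverse n-th power reduces the claim to a single step. *)
rewrite (_ : - _ * _ = - (ln (1 + kappa * k) / k * dt) * n%:R); last by ring.
rewrite expRM_natr expRN exprVn.
rewrite lef_pV2 ?posrE ?exprn_gt0 ?expR_gt0 //.
apply: lerXn2r; rewrite ?nnegrE ?expR_ge0 ?(ltW d0) //.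
by apply: exp_interpolation => //; rewrite dt0.
Qed.
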